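(* Let $\mu=e^{v(r)}\,dx$, $r=|x|$, be a radially symmetric measure on $\mathbb{R}^d$ with increasing $v$. Assume that $v''\ge 1$ and let $r_0\ge\sqrt{d+2}$. Then among all the open sets $A$ with Lipschitz boundary satisfying $\mu(A)=\mu(B_{r_0})$, the ball $B_{r_0}=\{|x|\le r_0\}$ has the minimal surface measure; that is, $\mu^{+}(\partial A)\ge\mu^{+}(\partial B_{r_0})$ for every such $A$.
   Context: For a Borel measure $\mu$ on $\mathbb{R}^d$ and a Borel set $A$, the surface measure is $\mu^{+}(\partial A)=\liminf_{\varepsilon\to 0}\frac{\mu(A^\varepsilon)-\mu(A)}{\varepsilon}$, where $A^\varepsilon$ is the $\varepsilon$-neighborhood of $A$. If $\mu$ has a continuous density $\rho$, the surface measure is represented as $\mu^{+}=\rho\cdot\mathcal{H}^{d-1}$. Lipschitz boundary means that $\partial A$ is a finite union of graphs of Lipschitz functions. *)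

(* Defs.v *)
From HB Require Import structures.
From mathcomp Require Import all_boot all_order all_algebra.
From mathcomp Require Import all_classical all_reals all_analysis measurable_realfun.
Set Implicit Arguments.
Unset Strict Implicit.
Unset Printing Implicit Defensive.
Import Order.TTheory GRing.Theory Num.Theory.
Import numFieldNormedType.Exports.
Local Open Scope classical_set_scope.
Local Open Scope ring_scope.

(* The topology of 'rV[R]_d is the product topology, so this is R^d with its
   Borel sigma-algebra. *)
Definition borel_rV (R : realType) (d : nat) :=
  g_sigma_algebraType (@open 'rV[R]_d).

Section measurability.
Context (R : realType).

Lemma measurable_fun_rV (p : measure_display) (T : measurableType p)
    (d : nat) (f : T -> borel_rV R d) :
  (forall i, measurable_fun [set: T] (fun x => (f x : 'rV[R]_d) 0 i)) ->
  measurable_fun [set: T] f.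
Proof.
move=> mf.
apply: (@measurability _ _ _ _ setT f (@open 'rV[R]_d) erefl).
move=> _ [U oU <-]; rewrite setTI.
pose B (qk : 'rV[rat]_d * nat) : set 'rV[R]_d :=
  ball (map_mx (@ratr R) qk.1) (qk.2.+1%:R^-1).
pose V qk := [set x | B qk `<=` U /\ B qk (f x)].
have -> : f @^-1` U = \bigcup_qk V qk.
  apply/seteqP; split=> x /=; last by move=> [[q k] _ [sU]] /sU.
  move=> Ux.
  have [e /= e0 eU] : nbhs_ball (f x : 'rV[R]_d) U.
    by rewrite nbhs_ballE; exact: open_nbhs_nbhs.
  have e20 : 0 < e / 2 by rewrite divr_gt0.
  have [k _ kP] := near_infty_natSinv_lt (PosNum e20).
  have /= kE := kP k (leqnn k).
  pose r : R := k.+1%:R^-1.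
  have r0 : 0 < r by rewrite invr_gt0.
  have qP (i : 'I_d) : exists q : rat, ball ((f x : 'rV[R]_d) 0 i) r (ratr q).
    have [||y [/= By [q _ qy]]] :=
      @dense_rat R (ball ((f x : 'rV[R]_d) 0 i) r).
    - by exists ((f x : 'rV[R]_d) 0 i); exact: ballxx.
    - exact: ball_open.
    by exists q; rewrite qy.
  pose q : 'rV[rat]_d := \row_i projT1 (cid (qP i)).
  have Bq : ball (map_mx (@ratr R) q) r (f x : 'rV[R]_d).
    split=> // i j; apply: ball_sym; rewrite !mxE ord1.
    exact: projT2 (cid (qP j)).
  exists (q, k) => //; split => // y By; apply: eU.
  apply: (@le_ball _ _ _ (r + r)).
    by rewrite (splitr e) lerD// ltW.
  by apply: ball_triangle (By); exact: ball_sym.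
apply: countable_bigcupT_measurable => [|qk]; first exact: countableP.
have [sU|nsU] := pselect (B qk `<=` U); last first.
  by rewrite [V qk](_ : _ = set0)//; apply/seteqP; split=> x // [].
have -> : V qk = \bigcap_(i in [set: 'I_d])
    (fun x => (f x : 'rV[R]_d) 0 i) @^-1`
      ball (ratr (qk.1 0 i) : R) (qk.2.+1%:R^-1).
  apply/seteqP; split=> x /=.
    by move=> [_ [_ Bx]] i _; have := Bx 0 i; rewrite mxE.
  move=> Bx; split=> //; split; first by rewrite invr_gt0.
  by move=> i j; rewrite mxE ord1; exact: Bx.
apply: fin_bigcap_measurable => // i _.
rewrite -[X in measurable X]setTI; apply: mf => //.
exact: measurable_ball.
Qed.

Lemma measurable_coord (d : nat) (i : 'I_d) :
  measurable_fun [set: borel_rV R d] (fun x : borel_rV R d => (x : 'rV[R]_d) 0 i).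
Proof.
apply: (measurability _ (RGenOpens.measurableE R)).
move=> _ [_ [a [b ->]] <-]; rewrite setTI; apply: sub_sigma_algebra.
by apply: open_comp => [x _|]; [exact: coord_continuous|exact: interval_open].
Qed.

Definition cons_rV (d : nat) (p : R * borel_rV R d) : borel_rV R d.+1 :=
  row_mx (p.1)%:M (p.2 : 'rV[R]_d).

Definition uncons_rV (d : nat) (x : borel_rV R d.+1) : R * borel_rV R d :=
  (lsubmx (x : 'rV[R]_(1 + d)) 0 0, rsubmx (x : 'rV[R]_(1 + d))).

Lemma cons_rVK (d : nat) : cancel (@cons_rV d) (@uncons_rV d).
Proof.
by move=> [t x]; rewrite /uncons_rV /cons_rV row_mxKl row_mxKr mxE eqxx mulr1n.
Qed.

Lemma measurable_cons_rV (d : nat) : measurable_fun [set: _] (@cons_rV d).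
Proof.
apply: measurable_fun_rV => i; rewrite /cons_rV.
case: (@split_ordP 1 d i) => j ->.
- rewrite (_ : (fun _ => _) = fst); first exact: measurable_fst.
  by apply/funext => p; rewrite [LHS]row_mxEl mxE !ord1 eqxx mulr1n.
- rewrite (_ : (fun _ => _) = (fun x : borel_rV R d => (x : 'rV[R]_d) 0 j) \o snd).
    exact: measurableT_comp (measurable_coord j) measurable_snd.
  by apply/funext => p; rewrite [LHS]row_mxEr.
Qed.

Lemma measurable_uncons_rV (d : nat) : measurable_fun [set: _] (@uncons_rV d).
Proof.
apply/measurable_fun_pairP; split.
- rewrite (_ : _ \o _ = (fun x : borel_rV R d.+1 => (x : 'rV[R]_d.+1) 0 (lshift d (0 : 'I_1)))).
    exact: measurable_coord.
  by apply/funext => x /=; rewrite mxE.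
- apply: measurable_fun_rV => i.
  rewrite (_ : (fun _ => _) = (fun x : borel_rV R d.+1 => (x : 'rV[R]_d.+1) 0 (@rshift 1 d i))).
    exact: measurable_coord.
  by apply/funext => x /=; rewrite mxE.
Qed.

End measurability.

Section lebesgue_step.
Context (R : realType) (d : nat).
Variable m : {sigma_finite_measure set (borel_rV R d) -> \bar R}.

Definition lebesgue_rV_step : set (borel_rV R d.+1) -> \bar R :=
  pushforward (lebesgue_measure \x m)%E (@cons_rV R d).

Let step0 : lebesgue_rV_step set0 = 0%E.
Proof. by rewrite /lebesgue_rV_step /pushforward preimage_set0 measure0. Qed.

Let step_ge0 A : (0 <= lebesgue_rV_step A)%E.
Proof. exact: (measure_ge0 (lebesgue_measure \x m)%E). Qed.

Let step_sigma_additive : semi_sigma_additive lebesgue_rV_step.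
Proof.
move=> F mF tF mUF; rewrite /lebesgue_rV_step /pushforward preimage_bigcup.
have mpre B : measurable B -> measurable (@cons_rV R d @^-1` B).
  by move=> mB; rewrite -[X in measurable X]setTI; exact: measurable_cons_rV.
apply: measure_semi_sigma_additive => //.
- by move=> n; exact: mpre.
- apply/trivIsetP => /= i j _ _ ij; rewrite -preimage_setI.
  by move/trivIsetP : tF => /(_ _ _ _ _ ij) ->//; rewrite preimage_set0.
- by rewrite -preimage_bigcup; exact: mpre.
Qed.

HB.instance Definition _ := isMeasure.Build _ _ _ lebesgue_rV_step
  step0 step_ge0 step_sigma_additive.

Let step_sigma_finite : sigma_finite setT lebesgue_rV_step.
Proof.
have /sigma_finiteP[F [TF ndF Foo]] :=
  sigma_finiteT (@lebesgue_measure R : {sigma_finite_measure set _ -> \bar R}).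
have /sigma_finiteP[G [TG ndG Goo]] := sigma_finiteT m.
exists (fun k => @uncons_rV R d @^-1` (F k `*` G k)).
  apply/esym/seteqP; split=> // x _.
  have [n _ Fnx] : (\bigcup_k F k) (uncons_rV x).1 by rewrite -TF.
  have [k _ Gkx] : (\bigcup_k G k) (uncons_rV x).2 by rewrite -TG.
  exists (maxn n k) => //; split.
  - by move: Fnx; exact/subsetPset/ndF/leq_maxl.
  - by move: Gkx; exact/subsetPset/ndG/leq_maxr.
move=> k; have [mF Fk] := Foo k; have [mG Gk] := Goo k.
have mFG : measurable (F k `*` G k) by exact: measurableX.
split; first by rewrite -[X in measurable X]setTI; exact: measurable_uncons_rV.
rewrite /lebesgue_rV_step /pushforward -comp_preimage.
rewrite (_ : _ \o _ = id); last by apply/funext => x /=; rewrite cons_rVK.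
by rewrite preimage_id product_measure1E// lte_mul_pinfty// ge0_fin_numE.
Qed.

HB.instance Definition _ := Measure_isSigmaFinite.Build _ _ _ lebesgue_rV_step
  step_sigma_finite.

End lebesgue_step.

Fixpoint lebesgue_rV (R : realType) (d : nat) :
    {sigma_finite_measure set (borel_rV R d) -> \bar R} :=
  match d with
  | 0 => \d_((0 : 'rV[R]_0) : borel_rV R 0)
  | d'.+1 => lebesgue_rV_step (lebesgue_rV R d')
  end.

Section isoperimetry.
Context (R : realType) (d : nat).
Implicit Types (x y u : 'rV[R]_d) (A G D : set 'rV[R]_d).

Definition dot x y : R := \sum_i x 0 i * y 0 i.

(* The library norm on 'rV[R]_d is the sup norm. *)
Definition enorm x : R := Num.sqrt (dot x x).

Definition eball (r : R) : set 'rV[R]_d := [set x | enorm x <= r].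

Definition enbhd A (e : R) : set 'rV[R]_d :=
  [set x | exists2 a, A a & enorm (x - a) < e].

Definition radial_measure (v : R -> R) A : \bar R :=
  (\int[lebesgue_rV R d]_(x in A) (expR (v (enorm x)))%:E)%E.

Definition surface_measure (mu : set 'rV[R]_d -> \bar R) A : \bar R :=
  limf_einf (fun e : R => (mu (enbhd A e) - mu A) * (e^-1)%:E)%E 0^'+.

Definition boundary A : set 'rV[R]_d := closure A `\` A°.

(* Graph, over a subset D of the hyperplane orthogonal to the unit vector u, of
   a function Lipschitz on D.  As u is arbitrary, the graph may be taken in any
   orthonormal system of coordinates. *)
Definition lipschitz_graph G : Prop :=
  exists u D (f : 'rV[R]_d -> R) (L : R),
    [/\ dot u u = 1,
        forall y, D y -> dot y u = 0,
        forall y z, D y -> D z -> `|f y - f z| <= L * enorm (y - z) &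
        G = [set y + f y *: u | y in D]].

Definition lipschitz_boundary A : Prop :=
  exists (n : nat) (G : 'I_n -> set 'rV[R]_d),
    (forall i, lipschitz_graph (G i)) /\ boundary A = \bigcup_i G i.

End isoperimetry.

Arguments eball {R} d r.

(* Main.v *)
Require Import Defs.
From HB Require Import structures.
From mathcomp Require Import all_boot all_order all_algebra.
From mathcomp Require Import all_classical all_reals all_analysis.
From mathcomp Require Import measurable_realfun ring lra.
Import Order.TTheory GRing.Theory Num.Theory.
Import numFieldNormedType.Exports.
Local Open Scope classical_set_scope.
Local Open Scope ring_scope.

(** The comparison is a calibration carried out ray by ray.

    In dimension [d.+1], let [g r = r ^+ d * expR (v r)] be the density of the
    measure along a ray ([ray_density]), [P r] the integral of [g] over
    [0, r] ([ray_mass]) and [C = d / r0 + v' r0], the logarithmic derivative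
    of [g] at [r0] ([mean_curvature]): it is the weighted mean curvature of the
    sphere of radius [r0].

    Suppose that a nondecreasing function [G], with [0 <= G <= g] on the
    positive half-line, grows at rate at least [C * g] beyond some radius
    [rs <= r0].  Let [U] and [V] be the sections by a ray of an open set [A] and
    of its [e]-neighbourhood.  Both [U] and [U + e] lie in [V], so splitting [g]
    as [(g - G) + G], keeping the first summand on [U] and the second one on
    [U + e], gives
      int_V g >= int_U (g - G) + int_(U + e) G = int_U (g - G + G (. + e))
              >= int_U g + e C int_(U, r > rs) g
    ([ray_enlargement]).  Integration over all rays yields
      mu (A^e) >= mu A + e C mu (A \ B_rs)
    for every [e > 0] ([radial_measure_enlargement]).  Since [A] has the measure
    of the ball [B_r0], [mu (A \ B_rs)] is at least
    [mu B_r0 - mu B_rs = S (P r0 - P rs)], where [S] is the area of the unit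
    sphere.  If moreover [C (P r0 - P rs) = g r0], the difference quotients of
    [A] are bounded below by [S * g r0], and this is the surface measure of the
    ball.

    The function [G r = C (P r - P rs)_+] has these properties
    ([calibrating_profile]).  That [rs] exists, and that [G <= g] up to [r0],
    both follow from [g r0 - phi r * g r <= C (P r0 - P r)], that is from
    [(phi g)' <= C g], with [phi r = t (3 - t^2) / 2] and [t = r / r0].  As
    [v'' >= 1] and [0 <= phi <= 1], it is enough to check this inequality for
    [v r = r^2 / 2], where it becomes
      (1 - t^2) (d + 3 - 2 r0^2 + r0^2 t^2) <= 0;
    this is where [r0^2 >= d + 3], the dimension plus two, comes from.  Beyond
    [r0], [G <= g] because [d / r + v' r >= C].

    Polar coordinates ([ge0_integral_polar]) are obtained from the behaviour of
    Lebesgue measure under dilations only.  In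
      int_(1 <= |x| <= 2) int_(s > 0) f (s x) s^d ds dx,
    exchanging the integrals and substituting [y = s x] weighs every [y <> 0]
    with the integral of [1 / s] over [|y| / 2, |y|], which is [ln 2]. *)

Set Implicit Arguments.
Unset Strict Implicit.
Unset Printing Implicit Defensive.

(** * Lebesgue measure under affine maps and dilations *)

Section lebesgue_affine.
Context {R : realType}.
Local Notation mu := (@lebesgue_measure R).

Lemma preimage_affine_itv (k b x y : R) : 0 < k ->
  (fun t => k * t + b) @^-1` `]x, y] = `](x - b) / k, (y - b) / k]%classic.
Proof.
move=> k0; apply/seteqP; split=> t /=; rewrite !in_itv/=;
  by rewrite ltr_pdivrMr// ler_pdivlMr// ltrBlDr lerBrDr mulrC.
Qed.

(** Both sides integrate [f], the right-hand one against a multiple of the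
    image of Lebesgue measure under the affine map; the two measures agree on
    half-open intervals. *)
Lemma ge0_integral_lebesgue_affine (k b : R) (f : R -> \bar R) : 0 < k ->
  measurable_fun [set: R] f -> (forall t, 0 <= f t)%E ->
  (\int[mu]_t f t = k%:E * \int[mu]_t f (k * t + b)%R)%E.
Proof.
move=> k0 mf f0; pose K : {nonneg R} := NngNum (ltW k0).
pose phi (t : measurableTypeR R) : measurableTypeR R := k * t + b.
have mphi : measurable_fun setT phi.
  by apply: measurable_funD => //; exact: measurable_funM.
pose nu : {measure set (measurableTypeR R) -> \bar R} :=
  mscale K (measure_function_pushforward__canonical__measure_function_Measure
    mu mphi).
have muE A : measurable A -> mu A = nu A.
  move=> mA; apply: (@lebesgue_measure_unique R nu) => // _ [[x y]] _ <-.
  pose I : set R := `](x - b) / k, (y - b) / k]%classic.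
  transitivity (k%:E * mu I)%E; last by rewrite /I -preimage_affine_itv.
  rewrite /I !lebesgue_measure_itv/= !lte_fin ltr_pM2r ?invr_gt0// ltrD2r.
  case: ifPn => _; last by rewrite mule0.
  by rewrite -!EFinD -EFinM; congr EFin; field; rewrite gt_eqF.
transitivity (\int[nu]_t f t)%E.
  by apply: eq_measure_integral => A mA _; exact: muE.
rewrite ge0_integral_mscale//; congr (_ * _)%E.
by rewrite ge0_integral_pushforward.
Qed.

End lebesgue_affine.

Section lebesgue_rV_theory.
Context {R : realType}.
Local Notation mu := (@lebesgue_measure R).
Local Open Scope ereal_scope.

(** Tonelli, as [lebesgue_rV R d.+1] is the image of a product measure. *)
Lemma ge0_integral_lebesgue_rVS (d : nat) (f : borel_rV R d.+1 -> \bar R) :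
  measurable_fun [set: _] f -> (forall x, 0 <= f x) ->
  \int[lebesgue_rV R d.+1]_x f x =
  \int[mu]_t \int[lebesgue_rV R d]_x f (cons_rV (t, x)).
Proof.
move=> mf f0.
rewrite -(@fubini_tonelli1 _ _ _ _ _ mu (lebesgue_rV R d)
  (f \o @cons_rV R d)); last 2 first.
- exact: measurableT_comp mf (@measurable_cons_rV R d).
- by move=> x; exact: f0.
transitivity (\int[pushforward (lebesgue_measure \x lebesgue_rV R d)
    (@cons_rV R d)]_x f x) => //.
rewrite ge0_integral_pushforward//; exact: measurable_cons_rV.
Qed.

Lemma measurable_scale_rV (d : nat) (k : R) :
  measurable_fun [set: borel_rV R d]
    ((fun x => k *: (x : 'rV[R]_d)) : borel_rV R d -> borel_rV R d).
Proof.
apply: measurable_fun_rV => i.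
rewrite (_ : (fun _ => _) = (fun x : borel_rV R d => k * (x : 'rV[R]_d) ord0 i)%R).
  by apply: measurable_funM => //; exact: measurable_coord.
by apply/funext => x; rewrite mxE.
Qed.

Lemma scale_cons_rV (d : nat) (k t : R) (x : borel_rV R d) :
  k *: (cons_rV (t, x) : 'rV[R]_d.+1) =
  cons_rV (k * t, (k *: (x : 'rV[R]_d) : borel_rV R d))%R :> 'rV[R]_d.+1.
Proof.
rewrite /cons_rV/=.
have := @scale_row_mx R 1 1 d k (t%:M) (x : 'rV[R]_d).
by rewrite scale_scalar_mx.
Qed.

(** The first coordinate contributes one factor [k] and the remaining ones
    [k ^+ d], by induction on the dimension. *)
Lemma ge0_integral_lebesgue_rV_scale (d : nat) (k : R)
    (f : borel_rV R d -> \bar R) : (0 < k)%R ->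
  measurable_fun [set: _] f -> (forall x, 0 <= f x) ->
  \int[lebesgue_rV R d]_x f x =
  (k ^+ d)%:E * \int[lebesgue_rV R d]_x f (k *: (x : 'rV[R]_d) : borel_rV R d).
Proof.
move=> k0; elim: d f => [|d IH] f mf f0.
  rewrite expr0 mul1e; apply: eq_integral => x _; congr f.
  by apply/rowP => -[].
rewrite !ge0_integral_lebesgue_rVS//; last first.
  exact: measurableT_comp mf (measurable_scale_rV k).
have mcons t : measurable_fun setT (fun x : borel_rV R d => cons_rV (t, x)).
  exact: measurableT_comp (@measurable_cons_rV R d) (pair1_measurable t).
have mF : measurable_fun setT
    (fun t : measurableTypeR R => \int[lebesgue_rV R d]_x f (cons_rV (t, x))).
  apply: (@measurable_fun_fubini_tonelli_F _ _ _ _ _ (lebesgue_rV R d) (f \o @cons_rV R d)).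
    exact: measurableT_comp mf (@measurable_cons_rV R d).
  by move=> x; exact: f0.
rewrite (ge0_integral_lebesgue_affine 0%R k0)//; last first.
  by move=> t; exact: integral_ge0.
have -> : \int[mu]_t \int[lebesgue_rV R d]_x f (cons_rV (k * t + 0, x)%R) =
    \int[mu]_t ((k ^+ d)%:E * \int[lebesgue_rV R d]_x
      f (k *: (cons_rV (t, x) : 'rV[R]_d.+1) : borel_rV R d.+1)).
  apply: eq_integral => t _; rewrite addr0 IH//; last exact: measurableT_comp mf (mcons _).
  by congr *%E; apply: eq_integral => x _; rewrite scale_cons_rV.
rewrite ge0_integralZl//.
- by rewrite muleA -EFinM exprS.
- apply: (@measurable_fun_fubini_tonelli_F _ _ _ _ _ (lebesgue_rV R d)
    ((fun x => f (k *: (x : 'rV[R]_d.+1) : borel_rV R d.+1)) \o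
      @cons_rV R d)) => [|x]; last exact: f0.
  apply: measurableT_comp (@measurable_cons_rV R d).
  exact: measurableT_comp mf (measurable_scale_rV k).
- by move=> t _; exact: integral_ge0.
- by rewrite lee_fin exprn_ge0// ltW.
Qed.

End lebesgue_rV_theory.

(** * The Euclidean norm *)

Section enorm_theory.
Context {R : realType} {d : nat}.
Implicit Types (x y : 'rV[R]_d).

Lemma dot_ge0 x : 0 <= dot x x.
Proof. by apply: sumr_ge0 => i _; rewrite -expr2 sqr_ge0. Qed.

Lemma enorm_ge0 x : 0 <= enorm x. Proof. exact: sqrtr_ge0. Qed.

Lemma enormZ (k : R) x : enorm (k *: x) = `|k| * enorm x.
Proof.
rewrite /enorm /dot -sqrtr_sqr -sqrtrM ?sqr_ge0// mulr_sumr; congr Num.sqrt.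
by apply: eq_bigr => i _; rewrite !mxE; ring.
Qed.

Lemma enorm0 : enorm (0 : 'rV[R]_d) = 0.
Proof. by rewrite -(scale0r (0 : 'rV[R]_d)) enormZ normr0 mul0r. Qed.

Lemma enorm_eq0 x : (enorm x == 0) = (x == 0).
Proof.
apply/idP/eqP => [|->]; last by rewrite enorm0.
rewrite sqrtr_eq0 => le0; have /eqP : dot x x = 0.
  by apply/eqP; rewrite eq_le le0 dot_ge0.
rewrite psumr_eq0 => [/allP z|i _]; last by rewrite -expr2 sqr_ge0.
apply/rowP => i; have /implyP/(_ isT) := z i (mem_index_enum i).
by rewrite -expr2 sqrf_eq0 mxE => /eqP.
Qed.

Lemma sqr_enorm x : enorm x ^+ 2 = dot x x.
Proof. by rewrite sqr_sqrtr// dot_ge0. Qed.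

(** Cauchy-Schwarz, from the expansion of the square of
    [enorm y *: x - enorm x *: y]. *)
Lemma dot_le_enorm x y : dot x y <= enorm x * enorm y.
Proof.
set a := enorm x; set b := enorm y.
have a0 : 0 <= a by exact: enorm_ge0.
have b0 : 0 <= b by exact: enorm_ge0.
have [ab0|ab0] := eqVneq (a * b) 0.
  rewrite ab0 /dot big1// => i _; apply/eqP; rewrite mulf_eq0.
  by move/eqP: ab0; rewrite mulf_eq0 => /orP[]; rewrite enorm_eq0 => /eqP->;
    rewrite mxE eqxx ?orbT.
have ab : 0 < a * b by rewrite lt_neqAle eq_sym ab0 mulr_ge0.
have : 0 <= dot (b *: x - a *: y) (b *: x - a *: y) by exact: dot_ge0.
have -> : dot (b *: x - a *: y) (b *: x - a *: y) =
    b ^+ 2 * dot x x - 2 * (a * b) * dot x y + a ^+ 2 * dot y y.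
  rewrite /dot !mulr_sumr -sumrB -big_split/=.
  by apply: eq_bigr => i _; rewrite !mxE; ring.
rewrite -!sqr_enorm -/a -/b.
have -> : b ^+ 2 * a ^+ 2 - 2 * (a * b) * dot x y + a ^+ 2 * b ^+ 2 =
    2 * (a * b) * (a * b - dot x y) by ring.
have ab2 : 0 < 2 * (a * b) by rewrite mulr_gt0.
by rewrite (pmulr_rge0 _ ab2) subr_ge0.
Qed.

Lemma ler_enormD x y : enorm (x + y) <= enorm x + enorm y.
Proof.
rewrite -(ler_pXn2r (n := 2))// ?nnegrE ?addr_ge0 ?enorm_ge0//.
rewrite sqrrD !sqr_enorm.
have -> : dot (x + y) (x + y) = dot x x + 2 * dot x y + dot y y.
  rewrite /dot !mulr_sumr -!big_split/=.
  by apply: eq_bigr => i _; rewrite !mxE; ring.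
by rewrite lerD2r lerD2l mulr_natl lerMn2r dot_le_enorm orbT.
Qed.

Lemma coord_le_enorm x i : `|x 0 i| <= enorm x.
Proof.
rewrite -sqrtr_sqr ler_wsqrtr// /dot (bigD1 i)//= expr2 lerDl.
by apply: sumr_ge0 => j _; rewrite -expr2 sqr_ge0.
Qed.

Lemma continuous_enorm : continuous (@enorm R d).
Proof.
move=> x; apply: continuous_comp; last exact: sqrt_continuous.
rewrite /continuous_at/dot.
apply: (@cvg_big _ _ _ _ _ (@add_continuous R) _ (nbhs x)) => i _.
by apply: cvgM; exact: coord_continuous.
Qed.

Lemma measurable_enorm :
  measurable_fun [set: borel_rV R d] (fun x : borel_rV R d => enorm (x : 'rV[R]_d)).
Proof.
apply: (measurability _ (RGenOpens.measurableE R)).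
move=> _ [_ [a [b ->]] <-]; rewrite setTI; apply: sub_sigma_algebra.
by apply: open_comp => [x _|]; [exact: continuous_enorm|exact: interval_open].
Qed.

Lemma open_enbhd (A : set 'rV[R]_d) (e : R) : open (enbhd A e).
Proof.
have -> : enbhd A e = \bigcup_(a in A) ((fun x => enorm (x - a)) @^-1` [set t | t < e]).
  by apply/seteqP; split=> x /= [a Aa xa]; exists a.
apply: bigcup_open => a _.
apply: (@open_comp _ _ (fun x => enorm (x - a)) [set t | t < e]) => [x _|].
  apply: (@continuous_comp _ _ _ (fun x => x - a) (@enorm R d)); last first.
    exact: continuous_enorm.
  apply: (@continuousB R 'rV[R]_d 'rV[R]_d id (cst a)) => //; exact: cst_continuous.
exact: open_lt.
Qed.

Lemma enbhd_eball (r e : R) : enbhd (eball d r) e `<=` eball d (r + e).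
Proof.
move=> x [a ar xa]; rewrite /eball /mkset -(subrK a x) addrC.
by rewrite (le_trans (ler_enormD _ _))// lerD// ltW.
Qed.

Lemma measurable_open (A : set 'rV[R]_d) : open A ->
  measurable (A : set (borel_rV R d)).
Proof. exact: (@sub_sigma_algebra _ setT (@open 'rV[R]_d) A). Qed.

Lemma measurable_eball (r : R) : measurable (eball d r : set (borel_rV R d)).
Proof.
rewrite -[X in measurable X]setTI.
have -> : eball d r = (fun x : borel_rV R d => enorm (x : 'rV[R]_d)) @^-1` `]-oo, r].
  by apply/seteqP; split=> x /=; rewrite in_itv.
exact: measurable_enorm.
Qed.

Lemma measurable_rV_origin : measurable [set (0 : 'rV[R]_d) : borel_rV R d].
Proof.
have -> : [set (0 : borel_rV R d)] = eball d 0.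
  apply/seteqP; split=> x /=.
    by move=> ->; rewrite /eball /mkset (_ : enorm _ = 0)//; exact: enorm0.
  by move=> x0; apply/eqP; rewrite -enorm_eq0 eq_le x0; exact: enorm_ge0.
exact: measurable_eball.
Qed.

End enorm_theory.

(** * Polar coordinates *)

Section polar_coordinates.
Context {R : realType} {d : nat}.
Local Notation mu := (@lebesgue_measure R).
Local Notation leb := (lebesgue_rV R d.+1).
Local Open Scope ereal_scope.

Definition shell : set (borel_rV R d.+1) :=
  [set x | (1 <= enorm (x : 'rV[R]_d.+1) <= 2)%R].

(** On the shell, dividing by [enorm x ^+ d.+1] accounts for the change from the
    parameter [s] of [s *: x] to the distance [r = s * enorm x] to the origin,
    and dividing by [ln 2] for the multiplicity of the shell parametrization. *)
Definition polar_weight (x : borel_rV R d.+1) : R :=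
  (\1_shell x / (ln 2 * enorm (x : 'rV[R]_d.+1) ^+ d.+1))%R.

Definition direction (x : borel_rV R d.+1) : 'rV[R]_d.+1 :=
  (enorm (x : 'rV[R]_d.+1))^-1 *: (x : 'rV[R]_d.+1).

Lemma enorm_direction x : shell x -> enorm (direction x) = 1%R.
Proof.
move=> /= /andP[x1 _]; have x0 : (0 < enorm (x : 'rV[R]_d.+1))%R.
  exact: lt_le_trans x1.
by rewrite enormZ ger0_norm ?invr_ge0 ?enorm_ge0// mulVf// gt_eqF.
Qed.

Lemma measurable_shell : measurable shell.
Proof.
have -> : shell = (fun x : borel_rV R d.+1 => enorm (x : 'rV[R]_d.+1)) @^-1` `[1%R, 2%R].
  by apply/seteqP; split=> x /=; rewrite in_itv.
rewrite -[X in measurable X]setTI.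
exact: measurable_enorm.
Qed.

Lemma lebesgue_rV_origin : leb [set (0%R : 'rV[R]_d.+1)] = 0.
Proof.
have m0 := @measurable_rV_origin R d.
have e : @cons_rV R d @^-1` [set (0%R : 'rV[R]_d.+1)] =
    [set 0%R] `*` [set (0%R : borel_rV R d)].
  apply/seteqP; split=> -[t x] /=.
    move=> tx0; have := cons_rVK (t, x); rewrite tx0 /uncons_rV => -[<- <-].
    split; first by rewrite !mxE.
    have -> // : rsubmx (0%R : 'rV[R]_(1 + d)) = 0%R.
    by apply/rowP => i; rewrite !mxE.
  by move=> [-> ->]; rewrite /cons_rV/= raddf0 row_mx0.
transitivity ((lebesgue_measure \x lebesgue_rV R d)
  (@cons_rV R d @^-1` [set (0%R : 'rV[R]_d.+1)])) => //.
rewrite e product_measure1E//.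
by rewrite [X in X * _](lebesgue_measure_set1 0%R) mul0e.
Qed.

Lemma derivable_itvcc_LRcontinuous (F : R -> R) (a b : R) :
  {in `[a, b]%R, forall x, derivable F x 1} -> (a < b)%R ->
  derivable_oo_LRcontinuous F a b.
Proof.
move=> dF ab.
have cF x : x \in `[a, b]%R -> {for x, continuous F}.
  move=> xab; apply/differentiable_continuous; rewrite -derivable1_diffP.
  exact: dF.
split.
- by move=> x xab; apply: dF; apply: subset_itv_oo_cc xab.
- by apply: cvg_at_right_filter; apply: cF; rewrite in_itv/= lexx ltW.
- by apply: cvg_at_left_filter; apply: cF; rewrite in_itv/= lexx ltW.
Qed.

Lemma integral_inv (a b : R) : (0 < a < b)%R ->
  \int[mu]_(s in `[a, b]) (s^-1)%:E = (ln b - ln a)%:E.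
Proof.
move=> /andP[a0 ab].
have pos x : x \in `[a, b]%R -> (0 < x)%R.
  by rewrite in_itv/= => /andP[ax _]; exact: lt_le_trans ax.
rewrite (@continuous_FTC2 R (fun s => s^-1)%R (@ln R))//.
- apply: continuous_in_subspaceT => x /[!inE] xab.
  by apply: inv_continuous; rewrite gt_eqF// pos.
- apply: derivable_itvcc_LRcontinuous => // x /pos x0.
  exact: (@ex_derive _ _ _ _ _ _ _ (is_derive1_ln x0)).
- move=> x xab; have x0 : (0 < x)%R by apply: pos; apply: subset_itv_oo_cc xab.
  by rewrite derive1E; apply: (@derive_val _ _ _ _ _ _ _ (is_derive1_ln x0)).
Qed.

Lemma measurable_invr : measurable_fun [set: R] (fun s : R => s^-1)%R.
Proof.
(* On nonnegative arguments the inverse is the real power of exponent -1;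
   passing through the square reduces to this case. *)
rewrite (_ : (fun _ => _) = (fun s => s * ((s * s) `^ (- 1)))%R).
  apply: measurable_funM => //; apply: measurableT_comp (measurable_powR _) _.
  exact: measurable_funM.
apply/funext => s; rewrite powR_inv1 -?expr2 ?sqr_ge0//.
have [->|s0] := eqVneq s 0%R; first by rewrite invr0 mul0r.
by rewrite expr2 invfM mulrA mulfV// mul1r.
Qed.

Lemma measurable_scale_pair : measurable_fun [set: R * borel_rV R d.+1]
  ((fun p => p.1 *: (p.2 : 'rV[R]_d.+1)) : _ -> borel_rV R d.+1).
Proof.
apply: measurable_fun_rV => i.
rewrite (_ : (fun _ => _) =
  (fun p : R * borel_rV R d.+1 => p.1 * (p.2 : 'rV[R]_d.+1) ord0 i)%R).
  apply: measurable_funM => //.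
  exact: measurableT_comp (measurable_coord i) measurable_snd.
by apply/funext => p; rewrite mxE.
Qed.

(** The multiples [s^-1 *: y] that lie in the shell are those with
    [enorm y / 2 <= s <= enorm y]. *)
Lemma integral_shell_section (y : borel_rV R d.+1) : y != 0%R :> 'rV[R]_d.+1 ->
  \int[mu]_s (\1_(shell : set 'rV[R]_d.+1) (s^-1 *: (y : 'rV[R]_d.+1)) *
    \1_(`]0%R, +oo[%classic : set R) s * s^-1)%:E = (ln 2)%:E.
Proof.
move=> y0; set a := enorm (y : 'rV[R]_d.+1).
have a0 : (0 < a)%R by rewrite lt_neqAle enorm_ge0 eq_sym enorm_eq0 y0.
have a2 : (0 < a / 2 < a)%R by apply/andP; split; lra.
transitivity (\int[mu]_(s in `[(a / 2)%R, a]) (s^-1)%:E); last first.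
  rewrite integral_inv// ln_div ?posrE//; congr EFin; ring.
rewrite [RHS]integral_mkcond; apply: eq_integral => s _.
have shE : (0 < s)%R -> (shell (s^-1 *: (y : 'rV[R]_d.+1)) : Prop) =
    (`[(a / 2)%R, a]%classic s : Prop).
  move=> s0; rewrite /shell/= in_itv/= enormZ -/a.
  rewrite ger0_norm ?invr_ge0 ?(ltW s0)//.
  rewrite ler_pdivlMl// ler_pdivrMl// mulr1 andbC.
  by rewrite ler_pdivrMr// [(s * 2)%R]mulrC.
rewrite patchE !indicE; have [s0|s0] := ltP 0%R s.
  rewrite (_ : (_ \in shell) = (s \in `[(a / 2)%R, a]%classic)); last first.
    by apply/idP/idP; rewrite !inE shE.
  rewrite (@mem_set _ `]0%R, +oo[%classic)/= ?in_itv/= ?s0//.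
  by case: ifPn => _; rewrite ?mul0r// !mul1r.
rewrite (@memNset _ `]0%R, +oo[%classic)/=; last first.
  by rewrite in_itv/= andbT; apply/negP; rewrite -leNgt.
rewrite mulr0 mul0r memNset//= in_itv/= => /andP[as1 _]; lra.
Qed.

(** The inner integral runs over the distance to the origin along the ray
    through [x], so that the ray problem is the same for all [x] of the shell. *)
Theorem ge0_integral_polar (f : borel_rV R d.+1 -> \bar R) :
  measurable_fun [set: _] f -> (forall x, 0 <= f x) ->
  \int[leb]_x f x = \int[leb]_x ((polar_weight x)%:E *
    \int[mu]_(r in `]0%R, +oo[) ((r ^+ d)%:E * f (r *: direction x))).
Proof.
move=> mf f0.
pose pos : set R := `]0%R, +oo[%classic.
have ln2_gt0 : (0 < ln (2 : R))%R by rewrite ln_gt0// ltr1n.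
(* [K] is the integrand over the shell in the variables [s] and [x], [L] the
   same integrand after the substitution [y = s *: x]. *)
pose M (p : R * borel_rV R d.+1) : \bar R :=
  (\1_pos p.1 * p.1 ^+ d)%:E * f (p.1 *: (p.2 : 'rV[R]_d.+1) : borel_rV R d.+1).
pose K (p : R * borel_rV R d.+1) : \bar R := (\1_shell p.2)%:E * M p.
pose W (p : R * borel_rV R d.+1) : R :=
  (\1_(shell : set 'rV[R]_d.+1) (p.1^-1 *: (p.2 : 'rV[R]_d.+1)) *
    \1_pos p.1 * p.1^-1)%R.
pose L (p : R * borel_rV R d.+1) : \bar R := (W p)%:E * f p.2.
have pos0 (s : R) : (0 <= \1_pos s * s^-1)%R.
  rewrite indicE; case: (boolP (s \in pos)); rewrite ?mul0r// inE /pos/= in_itv/= andbT.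
  by move=> s0; rewrite mul1r invr_ge0 ltW.
have posX (s : R) : (0 <= \1_pos s * s ^+ d)%R.
  rewrite indicE; case: (boolP (s \in pos)); rewrite ?mul0r// inE /pos/= in_itv/= andbT.
  by move=> s0; rewrite mul1r exprn_ge0 ?ltW.
have M0 p : 0 <= M p by rewrite mule_ge0// lee_fin.
have K0 p : 0 <= K p by rewrite mule_ge0// lee_fin.
have W0 p : (0 <= W p)%R by rewrite /W -mulrA mulr_ge0.
have L0 p : 0 <= L p by rewrite mule_ge0// lee_fin.
have mpos : measurable pos by exact: measurable_itv.
have mM : measurable_fun setT M.
  apply: emeasurable_funM; last exact: measurableT_comp mf measurable_scale_pair.
  apply/measurable_EFinP; apply: measurable_funM.
    exact: measurableT_comp (measurable_indic mpos) measurable_fst.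
  by apply: measurable_funX; exact: measurable_fst.
have mK : measurable_fun setT K.
  apply: emeasurable_funM mM; apply/measurable_EFinP.
  exact: measurableT_comp (measurable_indic measurable_shell) measurable_snd.
have mV : measurable_fun setT (fun s : R => s^-1)%R by exact: measurable_invr.
have mW : measurable_fun setT W.
  apply: measurable_funM; last exact: measurableT_comp mV measurable_fst.
  apply: measurable_funM; last first.
    exact: measurableT_comp (measurable_indic mpos) measurable_fst.
  pose h (p : R * borel_rV R d.+1) := (p.1^-1%R, p.2).
  have mh : measurable_fun setT h.
    apply/measurable_fun_pairP; split; last exact: measurable_snd.
    exact: measurableT_comp mV measurable_fst.
  exact: measurableT_comp (measurable_indic measurable_shell)
    (measurableT_comp measurable_scale_pair mh).
have mL : measurable_fun setT L.
  apply: emeasurable_funM; last exact: measurableT_comp mf measurable_snd.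
  exact/measurable_EFinP.
have posE (s : R) : (0 < s)%R -> \1_pos s = 1%R :> R.
  by move=> s0; rewrite indicE mem_set//= /pos/= in_itv/= s0.
have pos_eq0 (s : R) : (s <= 0)%R -> \1_pos s = 0%R :> R.
  move=> s0; rewrite indicE memNset//= /pos/= in_itv/= andbT.
  by apply/negP; rewrite -leNgt.
have ray_integralE x : (polar_weight x)%:E *
    \int[mu]_(r in pos) ((r ^+ d)%:E * f (r *: direction x)) =
    ((ln 2)^-1)%:E * \int[mu]_s K (s, x).
  rewrite /polar_weight; have [xS|xS] := pselect (shell x); last first.
    rewrite indicE memNset// !mul0r mul0e integral0_eq ?mule0// => s _.
    by rewrite /K/= indicE memNset// mul0e.
  have l0 : (0 < enorm (x : 'rV[R]_d.+1))%R.
    by move: xS => /= /andP[x1 _]; exact: lt_le_trans x1.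
  set l := enorm _ in l0 *.
  have -> : (\1_shell x / (ln 2 * l ^+ d.+1) = (ln 2)^-1 * l ^- d * l^-1)%R.
    rewrite indicE mem_set// exprS mul1r !invfM; ring.
  have -> : \int[mu]_(r in pos) ((r ^+ d)%:E * f (r *: direction x)) =
      l%:E * \int[mu]_s M ((l * s + 0)%R, direction x).
    rewrite -(@ge0_integral_lebesgue_affine _ l 0%R (fun s => M (s, direction x)))//.
      rewrite integral_mkcond; apply: eq_integral => r _.
      rewrite patchE /M/= indicE; case: ifPn => _; first by rewrite mul1r.
      by rewrite mul0r mul0e.
    exact: measurableT_comp mM (pair2_measurable (direction x : borel_rV R d.+1)).
  rewrite muleA -EFinM mulfVK ?gt_eqF// EFinM -muleA; congr *%E.
  rewrite -ge0_integralZl//; last 2 first.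
  - apply: measurableT_comp mM _; apply/measurable_fun_pairP; split.
      by apply: measurable_funD => //; exact: measurable_funM.
    exact: measurable_cst.
  - by rewrite lee_fin invr_ge0 exprn_ge0// ltW.
  apply: eq_integral => s _; rewrite addr0 /K/M/= [\1_shell _]indicE mem_set// mul1e.
  have -> : ((l * s) *: direction x = s *: (x : 'rV[R]_d.+1))%R.
    by rewrite /direction scalerA -/l mulrC mulKf// gt_eqF.
  rewrite muleA -EFinM; congr (_%:E * _).
  have -> : \1_pos (l * s)%R = \1_pos s :> R.
    have [s0|s0] := ltP 0%R s; first by rewrite !posE// mulr_gt0.
    by rewrite !pos_eq0// pmulr_rle0.
  by rewrite exprMn mulrCA mulKf// expf_neq0// gt_eqF.
have dilation_integralE s : \int[leb]_x K (s, x) = \int[leb]_y L (s, y).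
  have [s0|s0] := ltP 0%R s; last first.
    by rewrite !integral0_eq// => x _; rewrite /K/M/L/W/= pos_eq0//
      ?mulr0 mul0r mul0e ?mule0.
  have mLs := measurableT_comp mL (pair1_measurable s).
  rewrite [RHS](ge0_integral_lebesgue_rV_scale s0)//.
  rewrite -ge0_integralZl//; last 2 first.
  - exact: measurableT_comp mLs (measurable_scale_rV s).
  - by rewrite lee_fin exprn_ge0// ltW.
  apply: eq_integral => x _; rewrite /L/W/K/M/= posE// !muleA -!EFinM; congr (_%:E * _).
  rewrite scalerA mulVf ?gt_eqF// scale1r exprSr.
  by field; rewrite gt_eqF.
have weight_integralE (y : borel_rV R d.+1) : y != 0%R :> 'rV[R]_d.+1 ->
    \int[mu]_s L (s, y) = (ln 2)%:E * f y.
  move=> y0; transitivity (\int[mu]_s (W (s, y))%:E * f y); last first.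
    by rewrite -(integral_shell_section y0).
  rewrite /L/= ge0_integralZr//.
  - apply/measurable_EFinP; exact: measurableT_comp mW (pair2_measurable y).
  - by move=> s _; rewrite lee_fin.
under [RHS]eq_integral do rewrite ray_integralE.
have mK2 : measurable_fun setT (fun x => \int[mu]_s K (s, x)).
  exact: (@measurable_fun_fubini_tonelli_G _ _ _ _ R mu K).
have mL2 : measurable_fun setT (fun x => \int[mu]_s L (s, x)).
  exact: (@measurable_fun_fubini_tonelli_G _ _ _ _ R mu L).
have ge0 (F : R * borel_rV R d.+1 -> \bar R) x :
    (forall p, 0 <= F p) -> 0 <= \int[mu]_s F (s, x).
  by move=> F0; exact: integral_ge0.
rewrite ge0_integralZl//; last 2 first.
- by move=> x _; exact: ge0.
- by rewrite lee_fin invr_ge0 ltW.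
(* Integrate in [x] first, where the dilation by [s] is available, then in [s]
   again, where only the weight depends on [s]. *)
rewrite -(@fubini_tonelli _ _ _ _ R mu leb K)//.
under [in RHS]eq_integral do rewrite dilation_integralE.
rewrite (@fubini_tonelli _ _ _ _ R mu leb L)//.
have m0 : measurable [set (0%R : borel_rV R d.+1)] by exact: measurable_rV_origin.
rewrite (@ge0_negligible_integral _ _ _ leb setT [set (0%R : borel_rV R d.+1)])//;
  last exact: lebesgue_rV_origin.
rewrite [in RHS](@ge0_negligible_integral _ _ _ leb setT 
  [set (0%R : borel_rV R d.+1)])//; last 2 first.
- by move=> x _; exact: ge0.
- exact: lebesgue_rV_origin.
transitivity (((ln 2)^-1)%:E *
  \int[leb]_(x in setT `\` [set (0%R : borel_rV R d.+1)]) ((ln 2)%:E * f x)).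
  rewrite ge0_integralZl//; last 3 first.
  - exact: measurableD.
  - exact: measurable_funS mf.
  - by rewrite lee_fin ltW.
  by rewrite muleA -EFinM mulVf ?mul1e// gt_eqF.
congr (_ * _); apply: eq_integral => y; rewrite inE => -[_ /eqP y0].
by rewrite weight_integralE.
Qed.

End polar_coordinates.

Section lebesgue_rV_bounded.
Context {R : realType}.

Lemma lebesgue_rV_box (d : nat) (M : R) :
  let B := [set x : borel_rV R d | forall i, `|(x : 'rV[R]_d) 0 i| <= M] in
  measurable B /\ (lebesgue_rV R d B < +oo)%E.
Proof.
move=> B0; rewrite {}/B0.
have mbox n : measurable [set x : borel_rV R n | forall i, `|(x : 'rV[R]_n) 0 i| <= M].
  have -> : [set x : borel_rV R n | forall i, `|(x : 'rV[R]_n) 0 i| <= M] =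
    \bigcap_(i in [set: 'I_n]) (fun x => (x : 'rV[R]_n) 0 i) @^-1` `[- M, M].
    apply/seteqP; split=> x /= H i; first by move=> _; rewrite /= in_itv/= -ler_norml.
    by have := H i I; rewrite /= in_itv/= -ler_norml.
  apply: fin_bigcap_measurable => // i _.
  rewrite -[X in measurable X]setTI; apply: measurable_coord => //.
split=> //; elim: d => [|d IH].
  rewrite /= diracE; by case: (_ \in _); rewrite ltry.
pose B n : set (borel_rV R n) := [set x | forall i, `|(x : 'rV[R]_n) 0 i| <= M].
have headE t (x : borel_rV R d) :
    (cons_rV (t, x) : 'rV[R]_d.+1) 0 (lshift d (0 : 'I_1)) = t.
  by rewrite [LHS]row_mxEl mxE eqxx mulr1n.
have tailE t (x : borel_rV R d) i :
    (cons_rV (t, x) : 'rV[R]_d.+1) 0 (@rshift 1 d i) = (x : 'rV[R]_d) 0 i.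
  by rewrite [LHS]row_mxEr.
have e : @cons_rV R d @^-1` (B d.+1) = `[- M, M]%classic `*` B d.
  apply/seteqP; split=> -[t x] /=; rewrite /B/=.
    move=> H; split; last by move=> i; rewrite -(tailE t).
    by rewrite in_itv/= -ler_norml -(headE t x).
  move=> [+ H] i; rewrite in_itv/= -ler_norml => tM.
  by case: (@split_ordP 1 d i) => j ->; rewrite ?tailE// ord1 headE.
change ((lebesgue_measure \x lebesgue_rV R d)%E (@cons_rV R d @^-1` (B d.+1)) < +oo)%E.
have mB : measurable (B d) by exact: mbox.
rewrite e product_measure1E//.
rewrite lte_mul_pinfty// ?ge0_fin_numE//.
rewrite [X in (X < _)%E](lebesgue_measure_itv).
by case: ifP => // _; rewrite -EFinD ltry.
Qed.

End lebesgue_rV_bounded.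

Section polar_weight.
Context {R : realType} (d : nat).
Local Notation leb := (lebesgue_rV R d.+1).
Local Open Scope ereal_scope.

Let ln2_gt0 : (0 < ln (2 : R))%R. Proof. by rewrite ln_gt0// ltr1n. Qed.

Lemma polar_weight_ge0 (x : borel_rV R d.+1) : (0 <= polar_weight x)%R.
Proof. by rewrite divr_ge0// mulr_ge0 ?(ltW ln2_gt0)// exprn_ge0// enorm_ge0. Qed.

Lemma measurable_polar_weight :
  measurable_fun [set: borel_rV R d.+1] (@polar_weight R d).
Proof.
apply: measurable_funM; first exact: measurable_indic measurable_shell.
apply: (measurableT_comp (@measurable_invr R)).
apply: measurable_funM => //; apply: measurable_funX; exact: measurable_enorm.
Qed.

Lemma polar_weight_eq0 (x : borel_rV R d.+1) : ~ shell x -> polar_weight x = 0%R.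
Proof. by move=> xS; rewrite /polar_weight indicE memNset// mul0r. Qed.

Lemma integral_polar_weight_lty : \int[leb]_x (polar_weight x)%:E < +oo.
Proof.
have [mB B_fin] := lebesgue_rV_box d.+1 (2 : R).
set B := [set x | _] in mB B_fin.
apply: (@le_lt_trans _ _ (\int[leb]_x (((ln 2)^-1)%:E * (\1_B x)%:E))).
  apply: ge0_le_integral => //.
  - by move=> x _; rewrite lee_fin polar_weight_ge0.
  - by apply/measurable_EFinP; exact: measurable_polar_weight.
  - by apply/measurable_EFinP; apply: measurable_funM => //; exact: measurable_indic.
  move=> x _; rewrite -EFinM lee_fin.
  have [xS|xS] := pselect (shell x); last first.
    by rewrite polar_weight_eq0// mulr_ge0// invr_ge0 ltW.
  have /andP[x1 x2] := xS.
  have xB : B x by move=> i; apply: le_trans x2; exact: coord_le_enorm.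
  rewrite /polar_weight !indicE !mem_set// mulr1 mul1r invfM.
  rewrite -[leRHS]mulr1 ler_wpM2l ?invr_ge0 ?(ltW ln2_gt0)//.
  by rewrite invf_le1 ?exprn_ege1// exprn_gt0// (lt_le_trans _ x1).
rewrite ge0_integralZl//; last 2 first.
- by apply/measurable_EFinP; exact: measurable_indic.
- by rewrite lee_fin invr_ge0 ltW.
by rewrite integral_indic// setIT lte_mul_pinfty// lee_fin invr_ge0 ltW.
Qed.

(** Taking [f] radial in the polar formula shows that the total weight is the
    area of the unit sphere. *)
Definition sphere_area : R := fine (\int[leb]_x (polar_weight x)%:E).

Lemma sphere_areaE : \int[leb]_x (polar_weight x)%:E = sphere_area%:E.
Proof.
rewrite fineK// ge0_fin_numE ?integral_polar_weight_lty//.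
by apply: integral_ge0 => x _; rewrite lee_fin polar_weight_ge0.
Qed.

Lemma sphere_area_ge0 : (0 <= sphere_area)%R.
Proof.
by apply: fine_ge0; apply: integral_ge0 => x _; rewrite lee_fin polar_weight_ge0.
Qed.

End polar_weight.

(** * The calibrating profile *)

Section radial_profile.
Context {R : realType}.
Local Notation mu := (@lebesgue_measure R).

Lemma MVT_pos (F dF : R -> R) (a b : R) : 0 < a <= b ->
  (forall x : R, 0 < x -> is_derive x 1 F (dF x)) ->
  exists2 c, a <= c <= b & F b - F a = dF c * (b - a).
Proof.
move=> /andP[a0 ab] DF.
have Dab (x : R) : x \in `[a, b] -> is_derive x 1 F (dF x).
  by rewrite in_itv/= => /andP[ax _]; apply: DF; exact: lt_le_trans ax.
have cF : {within `[a, b], continuous F}.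
  apply: derivable_within_continuous => x xab.
  exact: (@ex_derive _ _ _ _ _ _ _ (Dab _ xab)).
have DF' (x : R) : x \in `]a, b[ -> is_derive x 1 F (dF x).
  by move=> xab; apply: Dab; apply: subset_itv_oo_cc.
have [c cab E] := MVT_segment ab DF' cF.
by exists c => //; move: cab; rewrite in_itv.
Qed.

Lemma ndecr_pos (F dF : R -> R) (a b : R) : 0 < a <= b ->
  (forall x : R, 0 < x -> is_derive x 1 F (dF x)) ->
  (forall x : R, a <= x <= b -> 0 <= dF x) -> F a <= F b.
Proof.
move=> ab DF dF0; have [c cab E] := MVT_pos ab DF.
rewrite -subr_ge0 E mulr_ge0 ?dF0// subr_ge0; by case/andP: ab.
Qed.

Context (d : nat) (v : R -> R) (r0 : R).
Context (v_incr : forall r s : R, 0 <= r -> r <= s -> v r <= v s).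
Context (v_diff : forall r : R, 0 < r -> derivable v r 1).
Context (v_diff2 : forall r : R, 0 < r -> derivable (derive1 v) r 1).
Context (v_conv : forall r : R, 0 < r -> 1 <= derive1n 2 v r).
Context (r0_ge : Num.sqrt (d.+1%:R + 2) <= r0).
Local Notation v' := (derive1 v).

Let r0_gt0 : 0 < r0.
Proof.
apply: lt_le_trans r0_ge; rewrite sqrtr_gt0 addr_gt0// ltr0n.
Qed.

Let r0sq : d%:R + 3 <= r0 * r0.
Proof.
have d2 : (0 : R) <= d.+1%:R + 2 by rewrite addr_ge0.
have -> : d%:R + 3 = d.+1%:R + 2 :> R by rewrite -natr1; ring.
rewrite -[leLHS](sqr_sqrtr d2) -expr2 lerXn2r// nnegrE ?sqrtr_ge0//.
exact: ltW.
Qed.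

Let is_derive_v (x : R) : 0 < x -> is_derive x 1 v (v' x).
Proof. by move=> x0; rewrite derive1E; apply: DeriveDef => //; exact: v_diff. Qed.

Let is_derive_v' (x : R) : 0 < x -> is_derive x 1 v' (derive1n 2 v x).
Proof.
by move=> x0; rewrite /= derive1E; apply: DeriveDef => //; exact: v_diff2.
Qed.

Lemma potential_slope_incr (a b : R) : 0 < a <= b -> b - a <= v' b - v' a.
Proof.
move=> ab; have [c cab ->] := MVT_pos ab is_derive_v'.
case/andP: ab => a0 ab; case/andP: cab => ac _.
by rewrite -[leLHS]mul1r ler_wpM2r ?subr_ge0// v_conv// (lt_le_trans a0).
Qed.

(** Slopes increase at rate at least [1] and are nonnegative arbitrarily close
    to the origin, [v] being nondecreasing. *)
Lemma potential_slope_ge (r : R) : 0 < r -> r <= v' r.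
Proof.
move=> r_gt0; rewrite leNgt; apply/negP => vr.
(* If [v' r < r], a point [c <= e] with [0 <= v' c] contradicts
   [r - c <= v' r - v' c] as soon as [e < r - v' r]. *)
pose e := Num.min r (r - v' r) / 2.
have e0 : 0 < e by rewrite divr_gt0// lt_min r_gt0 subr_gt0.
have er : e <= r / 2 by rewrite ler_pM2r// ge_min lexx.
have ev : e <= (r - v' r) / 2 by rewrite ler_pM2r// ge_min lexx orbT.
have e2 : 0 < e / 2 <= e by lra.
have [c /andP[c1 c2] E] := MVT_pos e2 is_derive_v.
have v0 : 0 <= v' c.
  have : 0 <= v' c * (e - e / 2) by rewrite -E subr_ge0 v_incr//; lra.
  by rewrite pmulr_lge0//; lra.
have cr : 0 < c <= r by lra.
have := potential_slope_incr cr; lra.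
Qed.

(** Truncating the argument at [0] makes the density nondecreasing on the whole
    line, hence measurable, without continuity of [v] at the origin. *)
Definition ray_density (r : R) : R :=
  (Num.max r 0) ^+ d * expR (v (Num.max r 0)).

Local Notation g := ray_density.

Lemma ray_density_ge0 r : 0 <= g r.
Proof. by rewrite mulr_ge0 ?expR_ge0// exprn_ge0// le_max lexx orbT. Qed.

Lemma ray_densityE r : 0 <= r -> g r = r ^+ d * expR (v r).
Proof. by move=> r0'; rewrite /g max_l. Qed.

Lemma ray_density_ndecr : nondecreasing_fun g.
Proof.
move=> a b ab; have m : 0 <= Num.max a 0 <= Num.max b 0.
  by rewrite le_max lexx orbT/= ge_max !le_max ab lexx !orbT.
case/andP: m => m0 m1.
apply: ler_pM; rewrite ?expR_ge0 ?exprn_ge0//.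
  by rewrite lerXn2r// nnegrE// (le_trans m0).
by rewrite ler_expR v_incr.
Qed.

Lemma is_derive_ray_density (r : R) : 0 < r ->
  is_derive r 1 g ((d%:R / r + v' r) * g r).
Proof.
move=> r_gt0.
have D := is_derive_v r_gt0.
have D1 : is_derive r 1 ((@id R) ^+ d * (expR \o v)) ((d%:R / r + v' r) * g r).
  have De : is_derive r 1 (expR \o v) (expR (v r) * v' r).
    exact: (is_derive1_comp (is_derive_expR _) D).
  have Dx : is_derive r 1 ((@id R) ^+ d) ((d%:R * r ^+ d.-1) *: 1).
    exact: is_deriveX.
  have -> : (d%:R / r + v' r) * g r = ((@id R) ^+ d) r *: (expR (v r) * v' r) +
      (expR \o v) r *: ((d%:R * r ^+ d.-1) *: 1).
    rewrite ray_densityE ?ltW// /GRing.scale/= exprfctE/=.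
    case: d => [|n]; first by rewrite !expr0 !mul0r; ring.
    by rewrite exprS/=; field; rewrite gt_eqF.
  exact: is_deriveM.
apply: near_eq_is_derive D1; near=> x; rewrite /ray_density max_l.
  by rewrite mulrfctE exprfctE.
rewrite ltW//.
near: x; exact: lt_nbhsr.
Unshelve. all: by end_near. Qed.

Lemma integrable_ray_density (u : R) :
  mu.-integrable `[0, u] (EFin \o g).
Proof.
apply: measurable_bounded_integrable.
- exact: measurable_itv.
- rewrite /= lebesgue_measure_itv/=; case: ifP => // _.
  by rewrite -EFinD ltry.
- by apply: nondecreasing_measurable => //; exact: ray_density_ndecr.
- exists (g u); split; first exact: num_real.
  move=> M gM t /=; rewrite in_itv/= => /andP[_ tu].
  by rewrite ger0_norm ?ray_density_ge0// (le_trans _ (ltW gM))// ray_density_ndecr.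
Qed.

Definition ray_mass (r : R) : R := \int[mu]_(t in `[0, r]) g t.

Local Notation P := ray_mass.

Lemma ray_massE (r : R) : (\int[mu]_(t in `[0%R, r]) (g t)%:E = (P r)%:E)%E.
Proof.
by rewrite /P /Rintegral fineK//; exact/integrable_fin_num/integrable_ray_density.
Qed.

Lemma ray_mass_ge0 r : 0 <= P r.
Proof. by apply: Rintegral_ge0 => t _; exact: ray_density_ge0. Qed.

Lemma is_derive_ray_mass (r : R) : 0 < r -> is_derive r 1 P (g r).
Proof.
move=> r_gt0; have D := is_derive_ray_density r_gt0.
have cg : {for r, continuous g}.
  apply/differentiable_continuous; rewrite -derivable1_diffP.
  exact: (@ex_derive _ _ _ _ _ _ _ D).
have [||dP <-] := @continuous_FTC1_closed R g 0 r (r + 1) _ _ r_gt0 cg.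
- by rewrite ltrDl.
- exact: integrable_ray_density.
by rewrite derive1E; apply: DeriveDef.
Qed.

Lemma ray_mass_increment (a b : R) : 0 < a <= b ->
  g a * (b - a) <= P b - P a <= g b * (b - a).
Proof.
move=> ab; have [c /andP[ac cb] ->] := MVT_pos ab is_derive_ray_mass.
case/andP: ab => _ ab.
by rewrite !ler_wpM2r ?subr_ge0 ?ray_density_ndecr.
Qed.

Lemma continuous_ray_mass (u : R) : 0 <= u -> {within `[0, u], continuous P}.
Proof.
move=> u0; apply: parameterized_integral_continuous => //.
exact: integrable_ray_density.
Qed.

Lemma ray_mass0 : P 0 = 0.
Proof. by rewrite /P set_itv1 Rintegral_set1. Qed.

(** The logarithmic derivative of the ray density at [r0]. *)
Definition mean_curvature : R := d%:R / r0 + v' r0.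
Local Notation C := mean_curvature.

Lemma mean_curvature_gt0 : 0 < C.
Proof.
rewrite ltr_wpDl ?divr_ge0// ?ltW// (lt_le_trans r0_gt0)//.
exact: potential_slope_ge.
Qed.

(** The cubic with value [0] at the origin, and with value [1] and slope [0] at
    [r0]. *)
Definition cutoff (r : R) : R := r / r0 * (3 - (r / r0) ^+ 2) / 2.

Lemma cutoff_bounds r : 0 <= r <= r0 -> 0 <= cutoff r <= 1.
Proof.
move=> /andP[r_ge0 rr0]; rewrite /cutoff; set t := r / r0.
have t0 : 0 <= t by rewrite divr_ge0// ltW.
have t1 : t <= 1 by rewrite ler_pdivrMr// mul1r.
apply/andP; split.
  rewrite divr_ge0// mulr_ge0// subr_ge0.
  have : t ^+ 2 <= 1 by rewrite expr_le1.
  lra.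
have : 0 <= (1 - t) ^+ 2 * (2 + t) by rewrite mulr_ge0 ?sqr_ge0// addr_ge0.
have -> : (1 - t) ^+ 2 * (2 + t) = 2 * (1 - t * (3 - t ^+ 2) / 2) by field.
lra.
Qed.

(** The left-hand side is the derivative of [cutoff * ray_density] divided by
    [ray_density].  Since [0 <= cutoff <= 1], replacing [v' r] by [r] and [v' r0]
    by [r0] only strengthens the inequality, which becomes polynomial. *)
Lemma cutoff_calibrates r : 0 < r <= r0 ->
  3 / 2 * (1 - (r / r0) ^+ 2) / r0 + cutoff r * (d%:R / r + v' r) <= C.
Proof.
move=> rb; have /andP[r_gt0 rr0] := rb.
have slope := potential_slope_incr rb.
have slope_r := potential_slope_ge r_gt0.
have /andP[c0 c1] : 0 <= cutoff r <= 1 by apply: cutoff_bounds; rewrite ltW.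
have excess : cutoff r * (v' r - r) <= v' r0 - r0.
  have H : 0 <= v' r - r by rewrite subr_ge0.
  have : cutoff r * (v' r - r) <= 1 * (v' r - r) by rewrite ler_wpM2r.
  lra.
suff gauss : 3 / 2 * (1 - (r / r0) ^+ 2) / r0 + cutoff r * (d%:R / r + r)
    <= d%:R / r0 + r0.
  by rewrite /C; move: gauss excess; lra.
rewrite /cutoff; set t := r / r0; have rE : r = t * r0 by rewrite mulfVK// gt_eqF.
have t0 : 0 < t by rewrite divr_gt0.
have t1 : t <= 1 by rewrite ler_pdivrMr// mul1r.
rewrite -subr_ge0 rE.
(* The difference factors through [1 - t ^+ 2], [t = 1] being a point of
   equality; [r0sq] makes the other factor nonnegative. *)
have -> : d%:R / r0 + r0 - (3 / 2 * (1 - t ^+ 2) / r0 +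
    t * (3 - t ^+ 2) / 2 * (d%:R / (t * r0) + t * r0)) =
    (1 - t ^+ 2) * (2 * (r0 * r0) - (d%:R + 3) - (r0 * r0) * t ^+ 2) / (2 * r0).
  by field; rewrite !gt_eqF.
have t2 : t ^+ 2 <= 1 by rewrite expr_le1// ltW.
have X0 : 0 <= r0 * r0 * (1 - t ^+ 2).
  by rewrite mulr_ge0 ?subr_ge0// mulr_ge0// ltW.
apply: divr_ge0; last by rewrite mulr_ge0// ltW.
apply: mulr_ge0; first by rewrite subr_ge0.
by move: r0sq X0; lra.
Qed.

Lemma ray_mass_ndecr (a b : R) : 0 <= a <= b -> P a <= P b.
Proof.
move=> /andP[]; rewrite le_eqVlt => /predU1P[<- _|a0 ab].
  by rewrite ray_mass0 ray_mass_ge0.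
have /ray_mass_increment/andP[H _] : 0 < a <= b by rewrite a0.
by rewrite -subr_ge0 (le_trans _ H)// mulr_ge0 ?ray_density_ge0// subr_ge0.
Qed.

Lemma is_derive_cutoff (r : R) :
  is_derive r 1 cutoff (3 / 2 * (1 - (r / r0) ^+ 2) / r0).
Proof.
pose p : {poly R} := (3 / 2 / r0) *: 'X - (1 / 2 / r0 ^+ 3) *: 'X^3.
have -> : cutoff = horner p.
  apply/funext => x; rewrite /cutoff /p !(hornerE, hornerXn)/=; field.
  exact: lt0r_neq0.
have -> : 3 / 2 * (1 - (r / r0) ^+ 2) / r0 = (deriv p).[r].
  rewrite /p derivB !derivZ derivX derivXn !(hornerE, hornerXn, hornerMn)/=.
  field; exact: lt0r_neq0.
exact: is_derive_poly.
Qed.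

(** [C * P - cutoff * g] is nondecreasing up to [r0], and [cutoff r0 = 1]. *)
Lemma calibrated_growth (r : R) : 0 < r <= r0 ->
  g r0 - cutoff r * g r <= C * (P r0 - P r).
Proof.
move=> rb.
pose dF x := C *: g x - (cutoff x *: ((d%:R / x + v' x) * g x) +
  g x *: (3 / 2 * (1 - (x / r0) ^+ 2) / r0)).
have DF (x : R) : 0 < x -> is_derive x 1 (C *: P - cutoff * g) (dF x).
  move=> x0; have Dg := is_derive_ray_density x0.
  have DP := is_derive_ray_mass x0; have Dc := is_derive_cutoff x.
  exact: is_deriveB.
have F : (C *: P - cutoff * g) r <= (C *: P - cutoff * g) r0.
  apply: (ndecr_pos rb DF) => x /andP[rx xr0].
  have x0 : 0 < x by case/andP: rb => + _; move/lt_le_trans; apply.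
  have xb : 0 < x <= r0 by rewrite x0.
  rewrite /dF /GRing.scale/=.
  have -> : C * g x - (cutoff x * ((d%:R / x + v' x) * g x) +
      g x * (3 / 2 * (1 - (x / r0) ^+ 2) / r0)) =
    (C - (3 / 2 * (1 - (x / r0) ^+ 2) / r0 +
      cutoff x * (d%:R / x + v' x))) * g x by ring.
  by rewrite mulr_ge0 ?ray_density_ge0// subr_ge0 cutoff_calibrates.
have c1 : cutoff r0 = 1 by rewrite /cutoff mulfV ?gt_eqF//; field.
move: F; rewrite !fctE c1 /GRing.scale/=; lra.
Qed.

(** The slope [v' r] gains at least [r - r0], and [d / r] loses at most that
    much because [d <= r0 ^+ 2]. *)
Lemma curvature_ge (r : R) : r0 <= r -> C <= d%:R / r + v' r.
Proof.
move=> r0r; have rb : 0 < r0 <= r by rewrite r0_gt0.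
have r_gt0 : 0 < r by exact: lt_le_trans r0r.
have slope := potential_slope_incr rb.
suff : d%:R / r0 - d%:R / r <= r - r0 by rewrite /C; move: slope; lra.
have -> : d%:R / r0 - d%:R / r = (r - r0) * (d%:R / (r0 * r)).
  by field; rewrite !gt_eqF.
rewrite -[leRHS]mulr1 ler_wpM2l ?subr_ge0// ler_pdivrMr ?mulr_gt0// mul1r.
apply: (@le_trans _ _ (r0 * r0)); last by rewrite ler_pM2l.
by move: r0sq; lra.
Qed.

Lemma ray_density_growth (r : R) : r0 <= r -> C * (P r - P r0) <= g r - g r0.
Proof.
move=> r0r; have rb : 0 < r0 <= r by rewrite r0_gt0.
have DF (x : R) : 0 < x ->
    is_derive x 1 (g - C *: P) ((d%:R / x + v' x) * g x - C *: g x).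
  move=> x0; have Dg := is_derive_ray_density x0.
  have DP := is_derive_ray_mass x0.
  exact: is_deriveB.
have F : (g - C *: P) r0 <= (g - C *: P) r.
  apply: (ndecr_pos rb DF) => x /andP[r0x _].
  by rewrite /GRing.scale/= -mulrBl mulr_ge0 ?ray_density_ge0// subr_ge0 curvature_ge.
by move: F; rewrite !fctE /GRing.scale/=; lra.
Qed.

(** [calibrated_growth] at [r] tending to [0], where [cutoff] vanishes. *)
Lemma sphere_le_ball : g r0 <= C * P r0.
Proof.
apply/ler_addgt0Pl => e e0.
pose M := 3 / 2 / r0 * g r0.
have M0 : 0 <= M by rewrite mulr_ge0 ?ray_density_ge0// divr_ge0// ltW.
pose r := Num.min r0 (e / (M + 1)).
have M1 : 0 < M + 1 by lra.
have r_gt0 : 0 < r by rewrite lt_min r0_gt0 divr_gt0.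
have rb : 0 < r <= r0 by rewrite r_gt0 ge_min lexx.
have re : r * (M + 1) <= e by rewrite -ler_pdivlMr// ge_min lexx orbT.
have := calibrated_growth rb.
have P0 : 0 <= C * P r by rewrite mulr_ge0 ?ray_mass_ge0// ltW// mean_curvature_gt0.
suff : cutoff r * g r <= r * M by rewrite mulrBr; move: re P0; lra.
have /andP[_ rr0] := rb.
have t0 : 0 <= r / r0 by rewrite divr_ge0 ?ltW.
have t2 : 0 <= (r / r0) ^+ 2 by rewrite sqr_ge0.
have /andP[c0 _] : 0 <= cutoff r <= 1 by apply: cutoff_bounds; rewrite ltW.
apply: (@le_trans _ _ (cutoff r * g r0)).
  by rewrite ler_wpM2l// ray_density_ndecr.
have -> : r * M = r / r0 * (3 / 2) * g r0 by rewrite /M; field; exact: lt0r_neq0.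
rewrite ler_wpM2r ?ray_density_ge0// /cutoff -[leLHS]mulrA ler_wpM2l//.
by move: t2; lra.
Qed.

(** Intermediate value theorem for [P]; [sphere_le_ball] says that the value
    sought, [P r0 - g r0 / C], is nonnegative. *)
Lemma threshold_radius :
  exists2 rs, 0 <= rs <= r0 & C * (P r0 - P rs) = g r0.
Proof.
have C0 := mean_curvature_gt0.
have gC : 0 <= g r0 / C by rewrite divr_ge0 ?ray_density_ge0// ltW.
have gP : g r0 / C <= P r0 by rewrite ler_pdivrMr// mulrC sphere_le_ball.
have [||rs rsI E] := @IVT R P 0 r0 (P r0 - g r0 / C) (ltW r0_gt0).
- by apply: continuous_ray_mass; exact: ltW.
- rewrite ray_mass0 min_l ?ray_mass_ge0// max_r ?ray_mass_ge0//.
  by apply/andP; split; lra.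
exists rs; first by move: rsI; rewrite in_itv.
by rewrite E; field; exact: lt0r_neq0.
Qed.

Lemma calibrating_profile (rs : R) : 0 <= rs <= r0 ->
  C * (P r0 - P rs) = g r0 ->
  exists G : R -> R, [/\ nondecreasing_fun G,
    forall r, 0 < r -> 0 <= G r <= g r &
    forall r e, rs < r -> 0 <= e -> G r + e * C * g r <= G (r + e)].
Proof.
move=> /andP[rs0 rsr0] E; have C0 := mean_curvature_gt0.
pose G r := C * (P (Num.max r rs) - P rs); exists G; split.
- move=> a b ab; rewrite /G ler_wpM2l ?(ltW C0)// lerD2r ray_mass_ndecr//.
  by rewrite le_max rs0 orbT/= ge_max !le_max ab lexx orbT.
- move=> r r_gt0; rewrite /G; apply/andP; split.
    rewrite mulr_ge0 ?(ltW C0)// subr_ge0 ray_mass_ndecr// rs0/=.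
    by rewrite le_max lexx orbT.
  have [rrs|rsr] := leP r rs; first by rewrite subrr mulr0 ray_density_ge0.
  have -> : C * (P r - P rs) = g r0 - C * (P r0 - P r) by rewrite -E; ring.
  have [rr0|r0r] := leP r r0; last first.
    by have := ray_density_growth (ltW r0r); lra.
  have rb : 0 < r <= r0 by rewrite r_gt0.
  have := calibrated_growth rb.
  have /andP[_ c1] : 0 <= cutoff r <= 1 by apply: cutoff_bounds; rewrite ltW.
  have : cutoff r * g r <= 1 * g r by rewrite ler_wpM2r ?ray_density_ge0.
  lra.
- move=> r e rsr e0; rewrite /G !max_l ?(ltW rsr)//; last lra.
  have rb : 0 < r <= r + e by rewrite (le_lt_trans rs0 rsr)/=; lra.
  have /andP[H _] := ray_mass_increment rb.
  have : C * (g r * (r + e - r)) <= C * (P (r + e) - P r).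
    by rewrite ler_wpM2l ?(ltW C0).
  lra.
Qed.

End radial_profile.

(** * Enlarging a subset of a ray *)

Section ray_enlargement.
Context {R : realType}.
Local Notation mu := (@lebesgue_measure R).
Local Open Scope ereal_scope.

(** On [E], write [g] as [(g - G) + G]; the first summand is kept on [D] only,
    the second one on the translate of [D] only. *)
Lemma ray_enlargement (D E : set R) (g G H : R -> R) (e : R) :
  measurable D -> measurable E ->
  measurable_fun [set: R] g -> measurable_fun [set: R] G ->
  measurable_fun [set: R] H ->
  (forall r, E r -> (0 <= G r <= g r)%R) ->
  D `<=` E -> (forall r, D r -> E (r + e)%R) ->
  (forall r, D r -> (0 <= H r)%R /\ (G r + H r <= G (r + e))%R) ->
  \int[mu]_(r in D) (g r + H r)%:E <= \int[mu]_(r in E) (g r)%:E.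
Proof.
move=> mD mE mg mG mH Gg DE DeE HG.
have mS (f : R -> R) (B : set R) : measurable_fun [set: R] f ->
    measurable_fun B (fun r => (f r)%:E).
  by move=> mf; apply/measurable_EFinP; exact: measurable_funS mf.
have Ge : measurable_fun [set: R] (fun r => G (r + e))%R.
  apply: (measurableT_comp mG).
  by apply: measurable_funD.
have gG0 r : E r -> 0 <= (g r - G r)%:E.
  by move=> /Gg/andP[_]; rewrite lee_fin subr_ge0.
have G0 r : E r -> 0 <= (G r)%:E by move=> /Gg/andP[]; rewrite lee_fin.
have -> : \int[mu]_(r in E) (g r)%:E =
    \int[mu]_(r in E) (g r - G r)%:E + \int[mu]_(r in E) (G r)%:E.
  rewrite -ge0_integralD//; last 2 first.
  - by apply: mS; exact: measurable_funB.
  - exact: mS.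
  by apply: eq_integral => r _; rewrite -EFinD subrK.
have shift : \int[mu]_(r in D) (G (r + e))%:E <= \int[mu]_(r in E) (G r)%:E.
  pose W : set R := [set r | D (r - e)%R].
  have mW : measurable W.
    rewrite -[X in measurable X]setTI.
    have ms : measurable_fun [set: R] (fun r : R => r - e)%R.
      by apply: measurable_funB.
    exact: ms.
  have -> : \int[mu]_(r in D) (G (r + e))%:E = \int[mu]_(r in W) (G r)%:E.
    rewrite [RHS]integral_mkcond (@ge0_integral_lebesgue_affine _ 1 e)//.
    - rewrite mul1e [LHS]integral_mkcond; apply: eq_integral => r _.
      rewrite !patchE mul1r (_ : ((r + e)%R \in W) = (r \in D))//.
      by apply/idP/idP; rewrite !inE /W/= addrK.
    - by apply/(measurable_restrictT _ _).1 => //; exact: mS.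
    - move=> r; rewrite patchE; case: ifPn => // /[!inE] /DeE; rewrite subrK.
      exact: G0.
  apply: ge0_subset_integral => //; first exact: mS.
  by move=> r /DeE; rewrite subrK.
apply: le_trans (leeD2l _ shift).
apply: (@le_trans _ _ (\int[mu]_(r in D) (g r - G r)%:E +
    \int[mu]_(r in D) (G (r + e))%:E)); last first.
  rewrite leeD2r//; apply: ge0_subset_integral => //.
  by apply: mS; exact: measurable_funB.
rewrite -ge0_integralD//.
- apply: ge0_le_integral => //.
  - by move=> r Dr; have /andP[? ?] := Gg r (DE r Dr); have [? _] := HG r Dr;
      rewrite lee_fin; lra.
  - by apply: mS; exact: measurable_funD.
  - apply: emeasurable_funD; last exact: mS.
    by apply: mS; exact: measurable_funB.
  - move=> r Dr; have [_] := HG r Dr.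
    by rewrite -EFinD lee_fin; lra.
- by move=> r /DE; exact: gG0.
- by apply: mS; exact: measurable_funB.
- by move=> r /DeE; exact: G0.
- exact: mS.
Qed.

End ray_enlargement.

(** * The radial measure in polar coordinates *)

Section radial_measure_polar.
Context {R : realType} (d : nat) (v : R -> R).
Context (v_incr : forall r s : R, 0 <= r -> r <= s -> v r <= v s).
Local Notation mu := (@lebesgue_measure R).
Local Notation leb := (lebesgue_rV R d.+1).
Local Notation g := (ray_density d v).
Local Notation m := (radial_measure v : set 'rV[R]_d.+1 -> \bar R).
Local Open Scope ereal_scope.

Definition ray_section (E : set 'rV[R]_d.+1) (x : borel_rV R d.+1) : set R :=
  [set r | (0 < r)%R /\ E (r *: direction x)].

Lemma measurable_ray_section (E : set 'rV[R]_d.+1) x :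
  measurable (E : set (borel_rV R d.+1)) -> measurable (ray_section E x).
Proof.
move=> mE; pose p (r : R) : borel_rV R d.+1 := r *: direction x.
have mp : measurable_fun setT p.
  exact: measurableT_comp (@measurable_scale_pair R d)
    (pair2_measurable (direction x : borel_rV R d.+1)).
have -> : ray_section E x = `]0%R, +oo[%classic `&` p @^-1` E.
  by apply/seteqP; split=> r /=; rewrite in_itv/= andbT.
apply: measurableI; first exact: measurable_itv.
by rewrite -[X in measurable X]setTI; exact: mp.
Qed.

Lemma measurable_potential : measurable_fun [set: borel_rV R d.+1]
  (fun y => expR (v (enorm (y : 'rV[R]_d.+1)))).
Proof.
rewrite (_ : (fun _ => _) = expR \o (v \o Num.max 0%R) \o
    (fun y : borel_rV R d.+1 => enorm (y : 'rV[R]_d.+1))); last first.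
  by apply/funext => y /=; rewrite max_r ?enorm_ge0.
apply: measurableT_comp; last exact: measurable_enorm.
apply: measurableT_comp; first exact: measurable_expR.
apply: nondecreasing_measurable => // a b ab /=.
apply: v_incr; first by rewrite le_max lexx.
by rewrite ge_max !le_max ab lexx !orbT.
Qed.

Lemma measurable_ray_density : measurable_fun [set: R] g.
Proof. by apply: nondecreasing_measurable => //; exact: ray_density_ndecr. Qed.

Lemma radial_measure_polar (E : set 'rV[R]_d.+1) :
  measurable (E : set (borel_rV R d.+1)) ->
  m E = \int[leb]_x ((polar_weight x)%:E *
    \int[mu]_(r in ray_section E x) (g r)%:E).
Proof.
move=> mE; rewrite /radial_measure integral_mkcond.
rewrite [LHS]ge0_integral_polar; last 2 first.
- have [+ _] := measurable_restrictT (fun y : borel_rV R d.+1 =>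
    (expR (v (enorm (y : 'rV[R]_d.+1))))%:E) mE.
  apply; apply/measurable_EFinP; exact: measurable_funS measurable_potential.
- by move=> x; rewrite patchE; case: ifP => // _; rewrite lee_fin expR_ge0.
apply: eq_integral => x _.
have [xS|xS] := pselect (shell x); last first.
  by rewrite /polar_weight indicE memNset// !mul0r !mul0e.
congr *%E; rewrite integral_mkcond [RHS]integral_mkcond.
apply: eq_integral => r _; rewrite !patchE.
have [r0|r0] := ltP 0%R r; last first.
  rewrite !memNset//=; first by move=> [+ _]; rewrite ltNge r0.
  by rewrite in_itv/= andbT; apply/negP; rewrite -leNgt.
rewrite (@mem_set _ `]0%R, +oo[%classic)/= ?in_itv/= ?r0//.
have -> : (r \in ray_section E x) = (r *: direction x \in E).
  by apply/idP/idP; rewrite !inE => H; [case: H|split].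
case: ifPn => _; last by rewrite mule0.
rewrite -EFinM ray_densityE ?ltW// enormZ enorm_direction//.
by rewrite mulr1 ger0_norm ?ltW.
Qed.

Lemma measurable_ray_integral (E : set 'rV[R]_d.+1) :
  measurable (E : set (borel_rV R d.+1)) ->
  measurable_fun [set: borel_rV R d.+1]
    (fun x => \int[mu]_(r in ray_section E x) (g r)%:E).
Proof.
move=> mE.
have mdir : measurable_fun [set: borel_rV R d.+1]
    (fun x => direction x : borel_rV R d.+1).
  apply: (measurableT_comp (@measurable_scale_pair R d)
    (g := fun x : borel_rV R d.+1 => ((enorm (x : 'rV[R]_d.+1))^-1%R, x))).
  apply/measurable_fun_pairP; split; last exact: measurable_id.
  exact: measurableT_comp (@measurable_invr R) (@measurable_enorm R d.+1).
pose q (p : R * borel_rV R d.+1) : borel_rV R d.+1 := p.1 *: direction p.2.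
have mq : measurable_fun setT q.
  apply: (measurableT_comp (@measurable_scale_pair R d)
    (g := fun p : R * borel_rV R d.+1 => (p.1, direction p.2 : borel_rV R d.+1))).
  apply/measurable_fun_pairP; split; first exact: measurable_fst.
  exact: measurableT_comp mdir measurable_snd.
pose K (p : R * borel_rV R d.+1) : R :=
  (\1_(`]0%R, +oo[%classic : set R) p.1 *
   \1_(E : set (borel_rV R d.+1)) (q p) * g p.1)%R.
have K0 p : 0 <= (K p)%:E by rewrite lee_fin /K mulr_ge0 ?ray_density_ge0.
have mK : measurable_fun setT (fun p => (K p)%:E).
  apply/measurable_EFinP; apply: measurable_funM; last first.
    exact: measurableT_comp measurable_ray_density measurable_fst.
  apply: measurable_funM; last exact: measurableT_comp (measurable_indic mE) mq.
  exact: measurableT_comp (measurable_indic (measurable_itv _)) measurable_fst.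
rewrite (_ : (fun _ => _) = (fun x => \int[mu]_s (K (s, x))%:E)).
  exact: (@measurable_fun_fubini_tonelli_G _ _ _ _ R mu (fun p => (K p)%:E)).
apply/funext => x; rewrite integral_mkcond; apply: eq_integral => r _.
rewrite patchE /K /ray_section/=.
case: ifPn; rewrite ?notin_setE ?inE/= => H.
  by rewrite !indicE !mem_set//= ?in_itv/= ?H.1// ?mul1r//; exact: H.2.
apply/esym; rewrite !indicE; have [r0|r0] := boolP (r \in `]0%R, +oo[%classic); last first.
  by rewrite !mul0r.
rewrite (@memNset _ E) ?mulr0 ?mul0r// => Er; apply: H; split=> //.
by move: r0; rewrite inE/= in_itv/= andbT.
Qed.

End radial_measure_polar.

Section radial_measure_balls.
Context {R : realType} (d : nat) (v : R -> R).
Context (v_incr : forall r s : R, 0 <= r -> r <= s -> v r <= v s).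
Local Notation mu := (@lebesgue_measure R).
Local Notation leb := (lebesgue_rV R d.+1).
Local Notation g := (ray_density d v).
Local Notation P := (ray_mass d v).
Local Notation m := (radial_measure v : set 'rV[R]_d.+1 -> \bar R).
Local Open Scope ereal_scope.

Lemma ray_section_eball (r : R) (x : borel_rV R d.+1) : shell x ->
  ray_section (eball d.+1 r) x = `]0%R, r]%classic.
Proof.
move=> xS; apply/seteqP; split=> s; rewrite /ray_section/eball/= in_itv/=.
  by move=> [s0]; rewrite enormZ enorm_direction// mulr1 gtr0_norm// s0.
move=> /andP[s0 sr]; split=> //.
by rewrite enormZ enorm_direction// mulr1 gtr0_norm.
Qed.

Lemma radial_measure_eball (r : R) :
  m (eball d.+1 r) = (sphere_area d * P r)%:E.
Proof.
rewrite radial_measure_polar//; last exact: measurable_eball.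
rewrite EFinM -sphere_areaE -ge0_integralZr//; last 3 first.
- by apply/measurable_EFinP; exact: measurable_polar_weight.
- by move=> x _; rewrite lee_fin polar_weight_ge0.
- by rewrite lee_fin ray_mass_ge0.
apply: eq_integral => x _.
have [xS|xS] := pselect (shell x); last by rewrite polar_weight_eq0// !mul0e.
rewrite ray_section_eball// -ray_massE//; congr *%E.
apply: integral_itv_obnd_cbnd.
apply/measurable_EFinP; apply: measurable_funTS; exact: measurable_ray_density.
Qed.

Lemma measurable_radial_density (D : set (borel_rV R d.+1)) :
  measurable_fun D (fun y => (expR (v (enorm (y : 'rV[R]_d.+1))))%:E).
Proof.
by apply/measurable_EFinP; apply: measurable_funTS; exact: measurable_potential.
Qed.

Lemma le_radial_measure (E F : set 'rV[R]_d.+1) :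
  measurable (E : set (borel_rV R d.+1)) ->
  measurable (F : set (borel_rV R d.+1)) -> E `<=` F -> m E <= m F.
Proof.
move=> mE mF EF; apply: ge0_subset_integral => //.
exact: measurable_radial_density.
Qed.

Lemma radial_measure_setD (E F : set 'rV[R]_d.+1) :
  measurable (E : set (borel_rV R d.+1)) ->
  measurable (F : set (borel_rV R d.+1)) -> m E <= m (E `\` F) + m F.
Proof.
move=> mE mF; have mEF : measurable (E `\` F : set (borel_rV R d.+1)).
  exact: measurableD.
rewrite /radial_measure -(@ge0_integral_setU _ _ _ leb (E `\` F : set (borel_rV R d.+1)) F)//.
- apply: le_radial_measure => //; first exact: measurableU.
  by move=> x Ex; have [Fx|Fx] := pselect (F x); [right|left].
- exact: measurable_radial_density.
- by apply/disj_set2P; rewrite setDE -setIA setICl setI0.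
Qed.

End radial_measure_balls.

(** * Comparison of surface measures *)

Section enlargement.
Context {R : realType} (d : nat) (v : R -> R).
Context (v_incr : forall r s : R, 0 <= r -> r <= s -> v r <= v s).
Local Notation mu := (@lebesgue_measure R).
Local Notation leb := (lebesgue_rV R d.+1).
Local Notation g := (ray_density d v).
Local Notation m := (radial_measure v : set 'rV[R]_d.+1 -> \bar R).
Local Open Scope ereal_scope.

Lemma ray_section_sub_enbhd (A : set 'rV[R]_d.+1) (e : R) x : (0 < e)%R ->
  ray_section A x `<=` ray_section (enbhd A e) x.
Proof.
move=> e0 r [r0 Ar]; split=> //; exists (r *: direction x) => //.
by rewrite subrr [enorm _]enorm0.
Qed.

(** [A] being open, some [s] slightly larger than [r] also belongs to its
    section, and it is at distance less than [e] from [r + e]. *)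
Lemma ray_section_shift (A : set 'rV[R]_d.+1) (e r : R) x : open A ->
  (0 < e)%R -> shell x -> ray_section A x r ->
  ray_section (enbhd A e) x (r + e)%R.
Proof.
move=> oA e0 xS [r0 Ar]; split; first by rewrite addr_gt0.
have cs : {for r, continuous (fun s : R => s *: direction x)}.
  by move=> /=; exact: scalel_continuous.
have /cs : nbhs (r *: direction x) A by exact: open_nbhs_nbhs.
move=> /nbhs_ballP[del /= del0 Adel].
pose s := (r + Num.min del e / 2)%R.
have min0 : (0 < Num.min del e)%R by rewrite lt_min del0 e0.
have minl : (Num.min del e <= del)%R by rewrite ge_min lexx.
have minr : (Num.min del e <= e)%R by rewrite ge_min lexx orbT.
exists (s *: direction x).
  apply: Adel; rewrite /ball/= /s opprD addrA subrr sub0r normrN.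
  by rewrite gtr0_norm ?divr_gt0//; lra.
rewrite -scalerBl enormZ enorm_direction// mulr1 ger0_norm /s; last lra.
lra.
Qed.

(** [ray_enlargement] on every ray, with the gain [H] equal to [e * C * g] beyond
    [rs] and to [0] before. *)
Lemma radial_measure_enlargement (A : set 'rV[R]_d.+1) (G : R -> R)
    (rs e C : R) : open A -> (0 <= rs)%R -> (0 < e)%R -> (0 <= C)%R ->
  nondecreasing_fun G ->
  (forall r, 0 < r -> 0 <= G r <= g r)%R ->
  (forall r, rs < r -> G r + e * C * g r <= G (r + e))%R ->
  m A + (e * C)%:E * m (A `\` eball d.+1 rs) <= m (enbhd A e).
Proof.
move=> oA rs0 e0 C0 ndG Gg GC.
have eC0 : (0 <= e * C)%R by rewrite mulr_ge0// ltW.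
have mA := measurable_open oA; have mB := measurable_eball (d := d.+1) rs.
have mE := measurable_open (@open_enbhd R d.+1 A e).
have mAB : measurable (A `\` eball d.+1 rs : set (borel_rV R d.+1)).
  exact: measurableD.
have mg := measurable_ray_density d v_incr.
pose J (E : set 'rV[R]_d.+1) x := \int[mu]_(r in ray_section E x) (g r)%:E.
have J0 E x : 0 <= J E x.
  by apply: integral_ge0 => r _; rewrite lee_fin ray_density_ge0.
have mw : measurable_fun [set: borel_rV R d.+1] (fun x => (polar_weight x)%:E).
  by apply/measurable_EFinP; exact: measurable_polar_weight.
have w0 (x : borel_rV R d.+1) : 0 <= (polar_weight x)%:E.
  by rewrite lee_fin polar_weight_ge0.
have mwJ (E : set 'rV[R]_d.+1) : measurable (E : set (borel_rV R d.+1)) ->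
    measurable_fun [set: borel_rV R d.+1] (fun x => (polar_weight x)%:E * J E x).
  move=> mE'; apply: emeasurable_funM => //.
  exact: measurable_ray_integral.
have wJ0 E x : 0 <= (polar_weight x)%:E * J E x by rewrite mule_ge0.
rewrite !radial_measure_polar// -ge0_integralZl//; last 2 first.
- exact: mwJ.
- by move=> x _; exact: wJ0.
rewrite -ge0_integralD//; last 4 first.
- by move=> x _; exact: wJ0.
- exact: mwJ.
- by move=> x _; rewrite mule_ge0// ?lee_fin//; exact: wJ0.
- by apply: measurable_funeM; exact: mwJ.
apply: ge0_le_integral => //.
- move=> x _; apply: adde_ge0; first exact: wJ0.
  by apply: mule_ge0; [rewrite lee_fin|exact: wJ0].
- apply: emeasurable_funD; first exact: mwJ.
  by apply: measurable_funeM; exact: mwJ.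
- exact: mwJ.
move=> x _; have [xS|xS] := pselect (shell x); last first.
  by rewrite polar_weight_eq0// !mul0e mule0 adde0.
rewrite muleCA -ge0_muleDr//; last 2 first.
- exact: J0.
- by rewrite mule_ge0// ?lee_fin//; exact: J0.
rewrite lee_wpmul2l//.
pose H (r : R) : R := (e * C * (g r * \1_(`]rs, +oo[%classic : set R) r))%R.
have ind0 r : (0 <= g r * \1_(`]rs, +oo[%classic : set R) r)%R.
  by rewrite mulr_ge0 ?ray_density_ge0.
have mind : measurable_fun [set: R]
    (fun r => g r * \1_(`]rs, +oo[%classic : set R) r)%R.
  by apply: measurable_funM => //; exact: measurable_indic.
have mH : measurable_fun [set: R] H by exact: measurable_funM.
have mG : measurable_fun [set: R] G by exact: nondecreasing_measurable.
have mS := measurable_ray_section x mA.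
apply: (@le_trans _ _ (\int[mu]_(r in ray_section A x) (g r + H r)%:E)).
  rewrite le_eqVlt; apply/orP; left; apply/eqP.
  under [RHS]eq_integral do rewrite EFinD.
  rewrite ge0_integralD//; last 4 first.
  - by move=> r _; rewrite lee_fin ray_density_ge0.
  - by apply/measurable_EFinP; exact: measurable_funTS.
  - by move=> r _; rewrite lee_fin mulr_ge0.
  - by apply/measurable_EFinP; exact: measurable_funTS.
  congr (_ + _).
  under [RHS]eq_integral do rewrite EFinM.
  rewrite ge0_integralZl//; last 2 first.
  - by apply/measurable_EFinP; exact: measurable_funTS.
  - by move=> r _; rewrite lee_fin.
  congr *%E; rewrite /J [LHS]integral_mkcond [RHS]integral_mkcond.
  apply: eq_integral => r _; rewrite !patchE.
  case: (boolP (r \in ray_section A x)); last first.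
    rewrite notin_setE => nA; rewrite memNset// => -[r0 [Ar _]].
    by apply: nA.
  rewrite inE => -[r0 Ar].
  have [rrs|rrs] := ltP rs r.
    rewrite mem_set; last first.
      split=> //; split=> //; rewrite /eball/= enormZ enorm_direction// mulr1.
      by rewrite gtr0_norm//; apply/negP; rewrite -ltNge.
    by rewrite indicE mem_set ?mulr1//= in_itv/= rrs.
  rewrite memNset; last first.
    move=> [_ [_]]; apply; rewrite /eball/= enormZ enorm_direction// mulr1.
    by rewrite gtr0_norm.
  by rewrite indicE memNset ?mulr0//= in_itv/= andbT; apply/negP; rewrite -leNgt.
apply: (@ray_enlargement _ _ _ g G H e) => //.
- exact: measurable_ray_section.
- by move=> r [r0 _]; exact: Gg.
- exact: ray_section_sub_enbhd.
- by move=> r; exact: ray_section_shift.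
- move=> r [r0 _]; split; first by rewrite mulr_ge0.
  rewrite /H; have [rrs|rrs] := ltP rs r.
    by rewrite indicE mem_set ?mulr1 ?GC//= in_itv/= rrs.
  rewrite indicE memNset ?mulr0 ?mulr0 ?addr0; first by rewrite ndG// lerDl ltW.
  by rewrite /= in_itv/= andbT; apply/negP; rewrite -leNgt.
Qed.

End enlargement.

Section isoperimetric_comparison.
Context {R : realType} (d : nat) (v : R -> R) (r0 : R).
Context (v_incr : forall r s : R, 0 <= r -> r <= s -> v r <= v s).
Context (v_diff : forall r : R, 0 < r -> derivable v r 1).
Context (v_diff2 : forall r : R, 0 < r -> derivable (derive1 v) r 1).
Context (v_conv : forall r : R, 0 < r -> 1 <= derive1n 2 v r).
Context (r0_ge : Num.sqrt (d.+1%:R + 2) <= r0).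
Local Notation g := (ray_density d v).
Local Notation P := (ray_mass d v).
Local Notation C := (mean_curvature d v r0).
Local Notation m := (radial_measure v : set 'rV[R]_d.+1 -> \bar R).
Local Notation S := (sphere_area d : R).

(** The [e]-neighbourhood of the ball lies in the ball of radius [r0 + e], whose
    excess measure is at most [S * e * g (r0 + e)]. *)
Lemma surface_measure_eball_le :
  0 < r0 -> (surface_measure m (eball d.+1 r0) <= (S * g r0)%:E)%E.
Proof.
move=> r0_gt0; rewrite /surface_measure limf_einfE; apply: ge_ereal_sup.
move=> _ [V V0 <-]; apply/lee_addgt0Pr => n n0.
have S0 := @sphere_area_ge0 R d.
have cg : {for r0, continuous g}.
  apply/differentiable_continuous; rewrite -derivable1_diffP.
  exact: (@ex_derive _ _ _ _ _ _ _ (is_derive_ray_density d v_diff r0_gt0)).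
have n1 : 0 < n / (S + 1) by rewrite divr_gt0// ltr_wpDl.
have /cg : nbhs (g r0) (ball (g r0) (n / (S + 1))) by exact: nbhsx_ballx.
move=> /nbhs_ballP[del /= del0 Hdel].
have [e [[Ve edel] e0]] : exists e, (V e /\ e < del) /\ 0 < e.
  apply: (@filter_ex _ (0^'+)); near=> e; split; last by near: e; exact: nbhs_right_gt.
  by split; near: e; [exact: V0|exact: nbhs_right_lt].
apply: (@le_trans _ _ ((m (enbhd (eball d.+1 r0) e) - m (eball d.+1 r0)) * (e^-1)%:E)%E).
  by apply: ereal_inf_lbound; exists e.
have sub : enbhd (eball d.+1 r0) e `<=` eball d.+1 (r0 + e).
  exact: enbhd_eball.
have := le_radial_measure v_incr (measurable_open (@open_enbhd R d.+1 (eball d.+1 r0) e))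
  (measurable_eball (r0 + e)) sub.
rewrite !(radial_measure_eball d v_incr) => H.
apply: (@le_trans _ _ (((S * P (r0 + e))%:E - (S * P r0)%:E) * (e^-1)%:E)%E).
  by rewrite lee_wpmul2r// ?lee_fin ?invr_ge0 ?(ltW e0)// leeB.
rewrite -EFinB -EFinM -EFinD lee_fin -mulrBr -mulrA.
have rb : 0 < r0 <= r0 + e by rewrite r0_gt0/= lerDl ltW.
have /andP[_ Pe] := ray_mass_increment d v_incr v_diff rb.
have Pg : (P (r0 + e) - P r0) * e^-1 <= g (r0 + e).
  by rewrite ler_pdivrMr//; move: Pe; rewrite addrAC subrr add0r.
have ge : g (r0 + e) <= g r0 + n / (S + 1).
  have : ball (g r0) (n / (S + 1)) (g (r0 + e)).
    by apply: Hdel; rewrite /ball/= opprD addrA subrr sub0r normrN gtr0_norm.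
  by rewrite /ball/= ltr_norml => /andP[]; lra.
apply: (@le_trans _ _ (S * (g r0 + n / (S + 1)))).
  by rewrite ler_wpM2l// (le_trans Pg).
rewrite mulrDr lerD2l mulrA ler_pdivrMr ?ltr_wpDl//.
by rewrite mulrDr mulr1 mulrC lerDl ltW.
Unshelve. all: by end_near.
Qed.

(** By [radial_measure_enlargement] and [radial_measure_setD], the bound holds
    for each difference quotient, not only in the limit. *)
Lemma surface_measure_ge (A : set 'rV[R]_d.+1) : open A ->
  m A = m (eball d.+1 r0) -> ((S * g r0)%:E <= surface_measure m A)%E.
Proof.
move=> oA; rewrite (radial_measure_eball d v_incr) => A_vol.
have C0 := mean_curvature_gt0 v_incr v_diff v_diff2 v_conv r0_ge.
have [rs rsb E] := threshold_radius v_incr v_diff v_diff2 v_conv r0_ge.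
have [G [ndG Gg GC]] := calibrating_profile v_incr v_diff v_diff2 v_conv r0_ge rsb E.
have /andP[rs0 _] := rsb.
have S0 := @sphere_area_ge0 R d.
have mA := measurable_open oA.
rewrite /surface_measure limf_einfE; apply: le_ereal_sup_tmp.
exists (ereal_inf ((fun e : R => (m (enbhd A e) - m A) * (e^-1)%:E)%E @` [set e | 0 < e])).
  by exists [set e : R | 0 < e] => //; exact: nbhs_right_gt.
apply: le_ereal_inf_tmp => _ [e /= e0 <-].
have GCe r : rs < r -> G r + e * C * g r <= G (r + e).
  by move=> rsr; apply: GC => //; exact: ltW.
have grow := radial_measure_enlargement v_incr oA rs0 e0 (ltW C0) ndG Gg GCe.
have outer : ((S * (P r0 - P rs))%:E <= m (A `\` eball d.+1 rs))%E.
  have := radial_measure_setD v_incr mA (measurable_eball rs).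
  rewrite A_vol (radial_measure_eball d v_incr) -leeBlDr//.
  by rewrite -EFinB mulrBr.
rewrite A_vol lee_pdivlMr// leeBrDr//; apply: le_trans grow.
rewrite A_vol addeC leeD2l//.
apply: (@le_trans _ _ ((e * C)%:E * (S * (P r0 - P rs))%:E)%E); last first.
  by rewrite lee_wpmul2l// lee_fin mulr_ge0// ltW.
by rewrite -!EFinM lee_fin -E le_eqVlt; apply/orP; left; apply/eqP; ring.
Qed.

End isoperimetric_comparison.

Unset Implicit Arguments.

Theorem corollary6p8 (R : realType) (d : nat) (v : R -> R) (r0 : R)
  (d_gt0 : (0 < d)%N)
  (v_incr : forall r s : R, 0 <= r -> r <= s -> v r <= v s)
  (v_diff : forall r : R, 0 < r -> derivable v r 1)
  (v_diff2 : forall r : R, 0 < r -> derivable (derive1 v) r 1)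
  (v_conv : forall r : R, 0 < r -> 1 <= derive1n 2 v r)
  (r0_ge : Num.sqrt (d%:R + 2) <= r0)
  (A : set 'rV[R]_d) (A_open : open A) (A_lip : lipschitz_boundary A)
  (A_vol : radial_measure v A = radial_measure v (eball d r0)) :
  (surface_measure (radial_measure v) (eball d r0)
     <= surface_measure (radial_measure v) A)%E.
Proof.
case: d d_gt0 r0_ge A A_open A_lip A_vol => [//|d] _ r0_ge A A_open _ A_vol.
have r0_gt0 : 0 < r0.
  by apply: lt_le_trans r0_ge; rewrite sqrtr_gt0 addr_gt0// ltr0n.
apply: (le_trans (surface_measure_eball_le d v_incr v_diff r0_gt0)).
exact: surface_measure_ge.
Qed.
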